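(* Let $\mathbf{k}$ be an algebraically closed field of characteristic $0$. Let $R$ be a finitely generated positively graded $\mathbf{k}$-domain, and let $\mathcal{A}$ be a finitely generated positively graded $\mathbf{k}[t]$-algebra which is a domain, with the following properties: (a) $\mathcal{A}[t^{-1}]\cong R[t,t^{-1}]$ as $\mathbf{k}[t]$-modules and graded algebras. (b) The algebra $R'=\mathcal{A}/(t)$ is a graded semigroup algebra $\mathbf{k}[S]$, where $S\subset\mathbb{Z}_{\ge 0}\times\mathbb{Z}^d$ is a finitely generated semigroup. (c) The standard $\mathbb{G}_m$-action on $\mathbf{k}[t]$ extends to an action on $\mathcal{A}$ respecting its grading. Moreover, this $\mathbb{G}_m$-action acts on $R'$ through the torus $\mathbb{G}_m^d$ acting on the semigroup algebra $R'$. Then there is a full rank valuation $\mathfrak{v}:R\setminus\{0\}\to\mathbb{Z}_{\ge 0}\times\mathbb{Z}^d$ such that $R'\cong\mathbf{k}[S(R,\mathfrak{v})]$.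
   Context: Positively graded means $\mathbb{Z}_{\ge0}$-graded; the grading on $\mathbf{k}[S]$ is given by the first component of $S\subset\mathbb{Z}_{\ge0}\times\mathbb{Z}^d$, and $\mathbb{G}_m^d$ acts on $\mathbf{k}[S]$ through the $\mathbb{Z}^d$-component. A valuation $\mathfrak{v}:R\setminus\{0\}\to\Gamma$, with $\Gamma$ a totally ordered abelian group (here $\mathbb{Z}\times\mathbb{Z}^d$ with some total group order), satisfies $\mathfrak{v}(f+g)\ge\min\{\mathfrak{v}(f),\mathfrak{v}(g)\}$ whenever $f,g,f+g\ne0$, $\mathfrak{v}(fg)=\mathfrak{v}(f)+\mathfrak{v}(g)$ and $\mathfrak{v}(cf)=\mathfrak{v}(f)$ for $0\ne c\in\mathbf{k}$. Its value semigroup is $S(R,\mathfrak{v})=\{\mathfrak{v}(f)\mid 0\ne f\in R\}$. Its rank is the rank of the group generated by $S(R,\mathfrak{v})$, and it is full rank if this equals the Krull dimension $\dim(R)$. *)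

(* Defs.v *)
From HB Require Import structures.
From mathcomp Require Import all_boot all_order all_algebra finmap.
From mathcomp Require Import ring_quotient.
From mathcomp Require Import monalg.
From mathcomp Require mpoly.

Set Implicit Arguments.
Unset Strict Implicit.
Unset Printing Implicit Defensive.

Import GRing.Theory.

Local Open Scope fset_scope.
Local Open Scope ring_scope.

(* The monoid algebra R[M] of a commutative additive monoid M: finitely
   supported functions M -> R with the convolution product.  The library puts
   a ring structure on {malg R[M]} only when 0 is the sole invertible element
   of M, which excludes M = Z and M = Z x Z^d; the structure is therefore
   rebuilt here on an alias of the R-module {malg R[M]}. *)
Definition monAlg (R : comNzRingType) (M : nmodType) : Type := {malg R[M]}.

HB.instance Definition _ (R : comNzRingType) (M : nmodType) :=
  GRing.Lmodule.copy (monAlg R M) {malg R[M]}.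

(* Locked, so that conversion does not unfold products. *)
HB.lock Definition mamul (R : comNzRingType) (M : nmodType)
    (f g : {malg R[M]}) : {malg R[M]} :=
  \sum_(m <- msupp f) \sum_(n <- msupp g) << f@_m * g@_n *g (m + n)%R >>.

Section MonAlg.
Variables (R : comNzRingType) (M : nmodType).
Implicit Types f g : {malg R[M]}.

Definition mon (c : R) (m : M) : monAlg R M := mkmalgU m c.

Local Notation mamul := (@mamul R M).

Lemma mamulE f g : mamul f g =
  \sum_(m <- msupp f) \sum_(n <- msupp g) << f@_m * g@_n *g (m + n)%R >>.
Proof. by rewrite mamul.unlock. Qed.

Lemma mamulw (D E : {fset M}) f g :
  msupp f `<=` D -> msupp g `<=` E ->
  mamul f g = \sum_(m <- D) \sum_(n <- E) << f@_m * g@_n *g (m + n)%R >>.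
Proof.
move=> leD leE; rewrite mamulE (big_fset_incl _ leD) /=.
  apply/eq_bigr=> m _; apply/big_fset_incl => // n _ /mcoeff_outdom ->.
  by rewrite mulr0 monalgU0.
move=> m _ /mcoeff_outdom fm.
by rewrite big1 // => n _; rewrite fm mul0r monalgU0.
Qed.

Lemma mamulC : commutative mamul.
Proof.
move=> f g; rewrite !mamulE exchange_big; apply: eq_bigr => m _.
by apply: eq_bigr => n _; rewrite mulrC addrC.
Qed.

Lemma mamul0g g : mamul 0 g = 0.
Proof. by rewrite mamulE msupp0 big_seq_fset0. Qed.

Lemma mamulUU c1 c2 m1 m2 :
  mamul << c1 *g m1 >> << c2 *g m2 >> = << c1 * c2 *g (m1 + m2)%R >>.
Proof. by rewrite (mamulw msuppU_le msuppU_le) !big_seq_fset1 !mcoeffUU. Qed.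

Lemma mamulDl : left_distributive mamul +%R.
Proof.
move=> f1 f2 g.
rewrite [in RHS](mamulw (fsubsetUl _ (msupp f2)) (fsubset_refl _)).
rewrite [in RHS](mamulw (fsubsetUr (msupp f1) _) (fsubset_refl _)).
rewrite (mamulw (msuppD_le _ _) (fsubset_refl _)).
rewrite -big_split /=; apply/eq_bigr=> m _.
rewrite -big_split /=; apply/eq_bigr=> n _.
by rewrite mcoeffD mulrDl monalgUD.
Qed.

Lemma mamulDr : right_distributive mamul +%R.
Proof. by move=> f g1 g2; rewrite mamulC mamulDl !(mamulC f). Qed.

Lemma mamulg0 g : mamul g 0 = 0.
Proof. by rewrite mamulC mamul0g. Qed.

Lemma mamul_suml (I : Type) (r : seq I) (F : I -> {malg R[M]}) g :
  mamul (\sum_(i <- r) F i) g = \sum_(i <- r) mamul (F i) g.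
Proof.
by apply: (big_morph (fun f => mamul f g)) => [f1 f2|]; rewrite ?mamulDl ?mamul0g.
Qed.

Lemma mamul_sumr (I : Type) (r : seq I) (F : I -> {malg R[M]}) g :
  mamul g (\sum_(i <- r) F i) = \sum_(i <- r) mamul g (F i).
Proof.
by apply: (big_morph (mamul g)) => [f1 f2|]; rewrite ?mamulDr ?mamulg0.
Qed.

Lemma mamulA : associative mamul.
Proof.
move=> f g h; rewrite (monalgE f) (monalgE g) (monalgE h).
rewrite !mamul_suml; apply: eq_bigr => m _.
rewrite [LHS]mamul_sumr [X in _ = mamul X _]mamul_sumr [RHS]mamul_suml.
apply: eq_bigr => n _.
rewrite mamulUU !mamul_sumr; apply: eq_bigr => p _.
by rewrite !mamulUU mulrA addrA.
Qed.

Lemma mamul1g : left_id (<< 1 *g 0 >> : {malg R[M]}) mamul.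
Proof.
move=> g; rewrite [in LHS](monalgE g) mamul_sumr [RHS]monalgE.
by apply: eq_bigr => m _; rewrite mamulUU mul1r add0r.
Qed.

Lemma maoner_neq0 : (<< 1 *g 0 >> : {malg R[M]}) != 0.
Proof. by rewrite monalgU_eq0 oner_eq0. Qed.

HB.instance Definition _ := GRing.Zmodule_isComNzRing.Build (monAlg R M)
  mamulA mamulC mamul1g mamulDl maoner_neq0.

Lemma mascaleAl (c : R) (f g : monAlg R M) : c *: (f * g) = (c *: f) * g.
Proof.
have scE (h : {malg R[M]}) : c *: h = mamul << c *g 0 >> h.
  rewrite [in RHS](monalgE h) mamul_sumr.
  by apply: eq_bigr => m _; rewrite mamulUU add0r.
by rewrite [LHS]scE mamulA -scE.
Qed.

HB.instance Definition _ :=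
  GRing.Lmodule_isLalgebra.Build R (monAlg R M) mascaleAl.
HB.instance Definition _ := GRing.Lalgebra_isComAlgebra.Build R (monAlg R M).

Lemma monM c1 c2 m1 m2 :
  mon c1 m1 * mon c2 m2 = mon (c1 * c2) (m1 + m2) :> monAlg R M.
Proof. exact: mamulUU. Qed.

Lemma mon1 : mon 1 0 = 1 :> monAlg R M.
Proof. by []. Qed.

End MonAlg.

(* k[S], for a subset S of M closed under addition and containing 0, is the
   subalgebra of k[M] of the elements supported on S. *)
Definition supported (R : comNzRingType) (M : nmodType) (S : M -> Prop)
    (f : monAlg R M) : Prop :=
  forall m, m \in msupp f -> S m.

Section Algebras.
Variables (K : comNzRingType) (B : comAlgType K).

Definition finitely_generated : Prop :=
  exists (n : nat) (g : 'I_n -> B), forall b : B,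
    exists p : mpoly.mpoly n K, b = mpoly.mmap (@GRing.in_alg K B) g p.

(* K itself sits in degree 0: the graded pieces are K-submodules. *)
Record pos_grading (gr : nat -> B -> Prop) : Prop := PosGrading {
  gr0 : forall n, gr n 0;
  grD : forall n x y, gr n x -> gr n y -> gr n (x + y);
  grZ : forall n (c : K) x, gr n x -> gr n (c *: x);
  gr1 : gr 0%N 1;
  grM : forall m n x y, gr m x -> gr n y -> gr (m + n)%N (x * y);
  gr_span : forall x, exists (N : nat) (x_ : nat -> B),
    (forall n, gr n (x_ n)) /\ x = \sum_(n < N) x_ n;
  gr_direct : forall (N : nat) (x_ : nat -> B),
    (forall n, gr n (x_ n)) -> \sum_(n < N) x_ n = 0 ->
    forall n, (n < N)%N -> x_ n = 0
}.

End Algebras.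

Section Localization.
Variables (k : fieldType) (A AL : comAlgType {poly k}).

(* loc : A -> AL is the localization of A at the powers of t = 'X. *)
Record is_localization_at_t
    (loc : {lrmorphism A -> AL}) : Prop :=
  IsLocalization {
    loc_unit : exists u : AL, ('X : {poly k})%:A * u = 1;
    loc_frac : forall x : AL, exists (m : nat) (a : A),
      ('X^m : {poly k}) *: x = loc a;
    loc_ker : forall a : A, loc a = 0 ->
      exists m : nat, ('X^m : {poly k}) *: a = 0
  }.

Definition loc_gr (loc : A -> AL) (grA : nat -> A -> Prop) (n : nat) (x : AL)
  : Prop :=
  exists (m : nat) (a : A), grA n a /\ ('X^m : {poly k}) *: x = loc a.

End Localization.

Section Laurent.
Variables (k : fieldType) (R : comAlgType k).

(* R[t, t^-1]; the exponent i of t is the element i of the monoid int. *)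
Definition laurent := monAlg R int.

Definition laurent_of_poly (p : {poly k}) : laurent :=
  \sum_(i < size p) mon (p`_i)%:A (i%:Z).

Definition laurent_gr (grR : nat -> R -> Prop) (n : nat) (f : laurent) : Prop :=
  forall i : int, grR n (mcoeff i f).

End Laurent.

Section GmAction.
Variables (k : fieldType) (A : comAlgType {poly k}).

(* An algebraic action of G_m on the k-algebra A, given on k-points.  The field
   gm_regular says that the orbit maps are regular, i.e. that the action comes
   from a coaction A -> A[z, z^-1].  Values of act at z = 0 are irrelevant. *)
Record Gm_action (act : k -> A -> A) : Prop := GmAction {
  gm_one : forall a, act 1 a = a;
  gm_mul : forall z w, z != 0 -> w != 0 ->
    forall a, act (z * w) a = act z (act w a);
  gm_D : forall z, z != 0 -> forall a b, act z (a + b) = act z a + act z b;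
  gm_M : forall z, z != 0 -> forall a b, act z (a * b) = act z a * act z b;
  gm_Z : forall z, z != 0 -> forall (c : k) a,
    act z (c%:P *: a) = c%:P *: act z a;
  gm_regular : forall a, exists (N : nat) (e : 'I_N -> int) (b : 'I_N -> A),
    forall z, z != 0 -> act z a = \sum_(i < N) (z ^ e i)%:P *: b i
}.

(* The standard action on k[t] is (z . p)(t) = p(z t). *)
Definition extends_standard (act : k -> A -> A) : Prop :=
  forall z, z != 0 -> forall p : {poly k},
    act z p%:A = (p \Po (z *: 'X))%:A.

Definition respects_grading (act : k -> A -> A) (grA : nat -> A -> Prop)
  : Prop :=
  forall z, z != 0 -> forall n a, grA n a -> grA n (act z a).

End GmAction.

(* The ambient group Z x Z^d of exponents and values. *)
Definition Gam (d : nat) : zmodType := (int * 'rV[int]_d)%type.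

Section Torus.
Variables (k : fieldType) (d : nat).

(* Homomorphisms of algebraic groups G_m -> G_m^d. *)
Record cocharacter (lam : k -> 'I_d -> k) : Prop := Cocharacter {
  cochar_neq0 : forall z, z != 0 -> forall i, lam z i != 0;
  cochar_mul : forall z w, z != 0 -> w != 0 ->
    forall i, lam (z * w) i = lam z i * lam w i;
  cochar_regular : forall i, exists (p : {poly k}) (m : nat),
    forall z, z != 0 -> lam z i = p.[z] / z ^+ m
}.

(* The point tau of G_m^d maps chi^(n, m) to tau^m chi^(n, m). *)
Definition torus_act (tau : 'I_d -> k) (f : monAlg k (Gam d))
  : monAlg k (Gam d) :=
  \sum_(s <- msupp f)
    mon ((\prod_(i < d) tau i ^ ((s : Gam d).2 0 i)) * mcoeff s f) s.

End Torus.

Section Semigroups.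
Variable d : nat.
Implicit Types S : Gam d -> Prop.

Definition fg_semigroup S : Prop :=
  exists (n : nat) (g : 'I_n -> Gam d), forall s,
    S s <-> exists c : 'I_n -> nat, s = \sum_(i < n) g i *+ c i.

Definition generated_group S (x : Gam d) : Prop :=
  exists (n : nat) (s : 'I_n -> Gam d) (c : 'I_n -> int),
    (forall i, S (s i)) /\ x = \sum_(i < n) s i *~ c i.

Definition Z_independent (n : nat) (x : 'I_n -> Gam d) : Prop :=
  forall c : 'I_n -> int, \sum_(i < n) x i *~ c i = 0 -> forall i, c i = 0.

Definition has_rank (G : Gam d -> Prop) (r : nat) : Prop :=
  (exists x : 'I_r -> Gam d, (forall i, G (x i)) /\ Z_independent x) /\
  (forall (m : nat) (x : 'I_m -> Gam d),
     (forall i, G (x i)) -> Z_independent x -> (m <= r)%N).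

End Semigroups.

Section Krull.
Variable R : comNzRingType.

Definition prime_ideal (p : {pred R}) : Prop :=
  idealr_closed p /\ prime_idealr_closed p.

(* p 0, ..., p n is a strictly increasing chain of primes, of length n. *)
Definition prime_chain (n : nat) (p : nat -> {pred R}) : Prop :=
  (forall i, (i <= n)%N -> prime_ideal (p i)) /\
  (forall i, (i < n)%N -> {subset p i <= p i.+1} /\
     exists2 x, x \in p i.+1 & x \notin p i).

Definition has_krull_dim (n : nat) : Prop :=
  (exists p, prime_chain n p) /\
  (forall m p, prime_chain m p -> (m <= n)%N).

End Krull.

Section Valuations.
Variables (k : fieldType) (R : comAlgType k) (d : nat).
Variables (le : rel (Gam d)) (v : R -> Gam d).

Definition total_group_order : Prop :=
  [/\ reflexive le, antisymmetric le, transitive le, total le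
    & forall x y z, le x y -> le (x + z) (y + z)].

Definition val_min (x y : Gam d) : Gam d := if le x y then x else y.

(* v is a total function whose value at 0 is irrelevant. *)
Record valuation : Prop := Valuation {
  val_D : forall f g, f != 0 -> g != 0 -> f + g != 0 ->
    le (val_min (v f) (v g)) (v (f + g));
  val_M : forall f g, f != 0 -> g != 0 -> v (f * g) = v f + v g;
  val_Z : forall (c : k) f, c != 0 -> f != 0 -> v (c *: f) = v f
}.

Definition value_semigroup (s : Gam d) : Prop := exists2 f, f != 0 & v f = s.

Definition full_rank : Prop :=
  exists2 r, has_rank (generated_group value_semigroup) r & has_krull_dim R r.

End Valuations.

Section SpecialFibre.
Variables (k : fieldType) (A : comAlgType {poly k}) (d : nat).

Definition is_t_ideal (I : idealr A) : Prop :=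
  forall a : A, a \in I <-> exists b : A, a = 'X *: b.

(* The class of a in the quotient ring A/I. *)
Definition cls (I : idealr A) (a : A) : {ideal_quot I} :=
  (\pi_({ideal_quot I}) a)%qT.

(* psi is an isomorphism of graded k-algebras from A/I onto k[S], where A/I
   carries the grading induced by that of A and k[S] is graded by the first
   component of S. *)
Record graded_iso_semigroup_algebra (I : idealr A) (grA : nat -> A -> Prop)
    (S : Gam d -> Prop) (psi : {rmorphism {ideal_quot I} -> monAlg k (Gam d)})
  : Prop := GradedIso {
  iso_linear : forall (c : k) (a : A),
    psi (cls I (c%:P *: a)) = c *: psi (cls I a);
  iso_inj : injective psi;
  iso_image : forall f : monAlg k (Gam d),
    (exists x, psi x = f) <-> supported S f;
  iso_graded : forall (n : nat) (x : {ideal_quot I}),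
    (exists2 a, grA n a & cls I a = x) <->
    supported (fun s : Gam d => s.1 = n%:Z) (psi x)
}.

End SpecialFibre.

(* Main.v *)
(* Since the G_m-action lifts the standard action on k[t], A is graded by
   weights, t has weight 1, and rho : A -> R, the specialization at t = 1, is
   injective on weight spaces; the images of the weight spaces filter R, and the
   associated graded ring is A/(t) = k[S].  A nonzero f in R has a unique
   homogeneous lift a not divisible by t, and v(f) is the least exponent of the
   class of a in k[S], for a group order on Z x Z^d which first compares weights,
   in reverse.

   Let b be a maximal independent family of r generators of S, lifted to hs in A.
   A derivation of A that kills k, t and hs vanishes: each x in A satisfies
   w D(x) = t m with w not in (t) and m in A D(A), so on generators of A the
   system (diag(w) - t C) D = 0 has a determinant that is nonzero modulo t.  In
   characteristic 0 this makes A algebraic over k[t, hs], which replaces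
   Krull's intersection theorem (no nonzero element of A is divisible by all
   powers of t) and bounds independent families in A by r + 1.

   A chain of primes of length m yields m independent elements (x_i in p_i and
   not in p_(i-1)), so chains in R = A/(t - 1) have length at most r.
   Conversely the elements of R with values b are independent, and a chain of
   length r is built by going up along an integral extension. *)

(* An algebraic relation between classes modulo t does not lift to [A]: it acquires an error term
   divisible by t. Derivations tolerate that error: differentiating the approximate relation gives a
   linear equation with an error in t A D(A), and the equations for the finitely many generators are
   closed off by an adjugate, as in Nakayama's lemma. No fraction field is formed. Independence is
   phrased through towers of polynomial subalgebras, and derivations are extended only up to a
   nonzero factor, which is harmless because only their vanishing matters. That k[S] is a domain
   makes [v] additive: a product of lifts outside (t) stays outside (t). The torus hypothesis makes
   the weight a linear form on Z x Z^d, so a group order can compare it first. Weights are reversed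
   because, when the classes of two lifts cancel modulo t, their sum is divisible by t and its
   weight drops, while a valuation has to go up. *)
Require Import Defs.
From HB Require Import structures.
From mathcomp Require Import all_boot all_order all_algebra.
From mathcomp Require Import ring_quotient finmap monalg boolp ring.
From mathcomp Require mpoly classical_sets.

Set Implicit Arguments.
Unset Strict Implicit.
Unset Printing Implicit Defensive.

Import GRing.Theory.

Local Open Scope ring_scope.

(** * Towers of subalgebras *)

Definition isdom (B : comNzRingType) : Prop :=
  forall x y : B, x * y = 0 -> x = 0 \/ y = 0.

Section Towers.
Variables (k : fieldType) (B : comNzRingType) (i : {rmorphism k -> B}).
Implicit Types (E F : B -> Prop) (x y z : B) (p q : {poly B}) (s : seq B).

(** The field acts through a bare morphism [i], so that the results apply alike to [R] and to the
    k[t]-algebra [A] seen over k. *)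
Record ksub E : Prop := KSub {
  ksubC : forall c, E (i c);
  ksubD : forall x y, E x -> E y -> E (x + y);
  ksubM : forall x y, E x -> E y -> E (x * y)
}.

Definition coefs_in E p : Prop := forall n, E p`_n.

Definition adj E z x : Prop := exists2 p, coefs_in E p & x = p.[z].

Definition trans E z : Prop := forall p, coefs_in E p -> p.[z] = 0 -> p = 0.

Fixpoint gens s : B -> Prop :=
  if s is z :: s' then adj (gens s') z else fun x => exists c, x = i c.

(* Each element is transcendental over the subalgebra generated by the later
   ones. *)
Fixpoint indep s : Prop :=
  if s is z :: s' then trans (gens s') z /\ indep s' else True.

Definition kgenerated s : Prop :=
  forall E, ksub E -> (forall x, x \in s -> E x) -> forall x, E x.

Section Sub.
Variables (E : B -> Prop) (hE : ksub E).

Lemma ksub0 : E 0. Proof. by rewrite -(rmorph0 i); apply: ksubC. Qed.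
Lemma ksub1 : E 1. Proof. by rewrite -(rmorph1 i); apply: ksubC. Qed.
Lemma ksubN x : E x -> E (- x).
Proof. by move=> Ex; rewrite -mulN1r -(rmorphN1 i); apply: ksubM => //; apply: ksubC. Qed.
Lemma ksubX x n : E x -> E (x ^+ n).
Proof.
move=> Ex; elim: n => [|n IHn]; first by rewrite expr0; apply: ksub1.
by rewrite exprS; apply: ksubM.
Qed.
Lemma ksub_sum (I : Type) (r : seq I) (P : pred I) (f : I -> B) :
  (forall j, P j -> E (f j)) -> E (\sum_(j <- r | P j) f j).
Proof. by move=> Ef; apply: (big_ind E) => //; [exact: ksub0|exact: ksubD]. Qed.
Lemma ksub_prod (I : Type) (r : seq I) (P : pred I) (f : I -> B) :
  (forall j, P j -> E (f j)) -> E (\prod_(j <- r | P j) f j).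
Proof. by move=> Ef; apply: (big_ind E) => //; [exact: ksub1|exact: ksubM]. Qed.
Lemma ksub_nat n : E n%:R.
Proof. by rewrite -(rmorph_nat i); apply: ksubC. Qed.

Lemma coefs_in_polyC x : E x -> coefs_in E x%:P.
Proof. by move=> Ex n; rewrite coefC; case: ifP => // _; apply: ksub0. Qed.
Lemma coefs_inX : coefs_in E 'X.
Proof. by move=> n; rewrite coefX; apply: ksub_nat. Qed.
Lemma coefs_inD p q : coefs_in E p -> coefs_in E q -> coefs_in E (p + q).
Proof. by move=> hp hq n; rewrite coefD; apply: ksubD. Qed.
Lemma coefs_inM p q : coefs_in E p -> coefs_in E q -> coefs_in E (p * q).
Proof. by move=> hp hq n; rewrite coefM; apply: ksub_sum => j _; apply: ksubM. Qed.
Lemma coefs_inN p : coefs_in E p -> coefs_in E (- p).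
Proof. by move=> hp n; rewrite coefN; apply: ksubN. Qed.
Lemma coefs_inB p q : coefs_in E p -> coefs_in E q -> coefs_in E (p - q).
Proof. by move=> hp hq; apply: coefs_inD => //; apply: coefs_inN. Qed.
Lemma coefs_inXn p n : coefs_in E p -> coefs_in E (p ^+ n).
Proof.
move=> hp; elim: n => [|n IHn]; first by rewrite expr0; apply: coefs_in_polyC; apply: ksub1.
by rewrite exprS; apply: coefs_inM.
Qed.
Lemma coefs_in_horner p x : coefs_in E p -> E x -> E p.[x].
Proof.
move=> hp Ex; rewrite horner_coef; apply: ksub_sum => j _.
by apply: ksubM => //; apply: ksubX.
Qed.

Lemma ksub_adj z : ksub (adj E z).
Proof.
split=> [c|x y [p hp ->] [q hq ->]|x y [p hp ->] [q hq ->]].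
- by exists (i c)%:P; [apply: coefs_in_polyC; apply: ksubC|rewrite hornerC].
- by exists (p + q); [apply: coefs_inD|rewrite hornerD].
- by exists (p * q); [apply: coefs_inM|rewrite hornerM].
Qed.

Lemma sub_adj z x : E x -> adj E z x.
Proof. by move=> Ex; exists x%:P; [apply: coefs_in_polyC|rewrite hornerC]. Qed.

Lemma adj_gen z : adj E z z.
Proof. by exists 'X; [exact: coefs_inX|rewrite hornerX]. Qed.

End Sub.

Lemma adj_min E F z : ksub F -> (forall x, E x -> F x) -> F z ->
  forall x, adj E z x -> F x.
Proof.
move=> hF EF Fz x [p hp ->]; rewrite horner_coef; apply: (ksub_sum hF) => j _.
by apply: (ksubM hF); [exact: EF|exact: ksubX].
Qed.

Lemma ksub_gens s : ksub (gens s).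
Proof.
elim: s => [|z s IHs] /=; last exact: ksub_adj.
split=> [c|x y [c ->] [c' ->]|x y [c ->] [c' ->]]; first by exists c.
  by exists (c + c'); rewrite rmorphD.
by exists (c * c'); rewrite rmorphM.
Qed.

Lemma gens_mem s z : z \in s -> gens s z.
Proof.
elim: s => [//|y s IHs]; rewrite inE => /orP[/eqP->|/IHs hz].
  exact: (adj_gen (ksub_gens s)).
exact: (sub_adj (ksub_gens s)).
Qed.

Lemma gens_min s F : ksub F -> (forall x, x \in s -> F x) ->
  forall x, gens s x -> F x.
Proof.
move=> hF; elim: s => [_ x [c ->]|z s IHs Fs]; first exact: ksubC.
apply: (adj_min hF) => [x|].
  by apply: IHs => y ys; apply: Fs; rewrite inE ys orbT.
by apply: Fs; rewrite inE eqxx.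
Qed.

Lemma trans_sub E F z : (forall x, E x -> F x) -> trans F z -> trans E z.
Proof. by move=> EF hF p hp; apply: hF => n; apply: EF. Qed.

Lemma not_trans E z : ~ trans E z ->
  exists p, [/\ coefs_in E p, p.[z] = 0 & p != 0].
Proof.
move=> h; apply: contrapT => h'; apply: h => p hp pz.
by apply: contrapT => /eqP p0; apply: h'; exists p.
Qed.

End Towers.

(** * Extension of derivations *)

Record derivation (B : comNzRingType) (E : B -> Prop) (D : B -> B) : Prop :=
  Derivation {
    derD : forall x y, E x -> E y -> D (x + y) = D x + D y;
    derM : forall x y, E x -> E y -> D (x * y) = x * D y + y * D x
  }.

Section Extension.
Variables (k : fieldType) (B : comNzRingType) (i : {rmorphism k -> B}).
Variables (E : B -> Prop) (D : B -> B).
Hypotheses (hE : ksub i E) (hD : derivation E D).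
Implicit Types (p q : {poly B}).

Lemma der0 : D 0 = 0.
Proof.
have := derD hD (ksub0 hE) (ksub0 hE); rewrite addr0 => /eqP.
by rewrite -subr_eq0 opprD addNKr oppr_eq0 => /eqP.
Qed.

Lemma dmapE p n : (map_poly D p)`_n = D p`_n.
Proof. by rewrite coef_map_id0 // der0. Qed.

Lemma dmapD p q : coefs_in E p -> coefs_in E q ->
  map_poly D (p + q) = map_poly D p + map_poly D q.
Proof.
by move=> hp hq; apply/polyP => n; rewrite coefD !dmapE coefD (derD hD).
Qed.

Lemma dmapMX p : map_poly D (p * 'X) = map_poly D p * 'X.
Proof. by apply/polyP => -[|n]; rewrite dmapE !coefMX ?der0 ?dmapE. Qed.

Lemma dmapC c : map_poly D c%:P = (D c)%:P.
Proof. by apply/polyP => -[|n]; rewrite dmapE !coefC /= ?der0. Qed.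

Lemma dmapCM c p : E c -> coefs_in E p ->
  map_poly D (c%:P * p) = c%:P * map_poly D p + (D c)%:P * p.
Proof.
move=> Ec hp; apply/polyP => n; rewrite coefD dmapE !coefCM dmapE.
by rewrite (derM hD) // (mulrC p`_n).
Qed.

Lemma coefs_in_cons p c : coefs_in E (p * 'X + c%:P) -> coefs_in E p /\ E c.
Proof.
move=> h; split=> [n|].
  by have := h n.+1; rewrite coefD coefMX coefC /= addr0.
by have := h 0; rewrite coefD coefMX coefC /= add0r.
Qed.

Variables (z u xi : B).

(** This is [u] times the derivative of p(z) for the extension of [D] with value [xi / u] at [z];
    clearing the denominator keeps it in [B]. *)
Definition dext p := u * (map_poly D p).[z] + p^`().[z] * xi.

Lemma dextD p q : coefs_in E p -> coefs_in E q -> dext (p + q) = dext p + dext q.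
Proof. by move=> hp hq; rewrite /dext dmapD // derivD !hornerD; ring. Qed.

Lemma dextMX p : dext (p * 'X) = dext p * z + p.[z] * xi.
Proof.
by rewrite /dext dmapMX derivM derivX mulr1 hornerD !hornerM hornerX; ring.
Qed.

Lemma dextC c : dext c%:P = u * D c.
Proof. by rewrite /dext dmapC derivC !hornerC mul0r addr0. Qed.

Lemma dextCM c p : E c -> coefs_in E p ->
  dext (c%:P * p) = c * dext p + u * D c * p.[z].
Proof.
move=> Ec hp; rewrite /dext dmapCM // derivM derivC mul0r add0r hornerD !hornerM !hornerC; ring.
Qed.

Lemma dextM p q : coefs_in E p -> coefs_in E q ->
  dext (p * q) = p.[z] * dext q + q.[z] * dext p.
Proof.
move=> + hq; elim/poly_ind: p => [_|p c IHp /coefs_in_cons[hp Ec]].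
  by rewrite mul0r -polyC0 dextC der0 !hornerC; ring.
have hC := coefs_in_polyC hE Ec; have hX := coefs_inX hE.
have hpX : coefs_in E (p * 'X) by exact: (coefs_inM hE).
rewrite mulrDl dextD //; [|by apply: (coefs_inM hE)|by apply: (coefs_inM hE)].
rewrite mulrAC dextMX IHp // dextCM // hornerM dextD // dextC dextMX.
by rewrite hornerD hornerM hornerX hornerC; ring.
Qed.

(** By additivity, killing the relations of [z] makes [dext p] depend only on p(z). Nothing is
    required of [D'] outside [adj E z]. *)
Lemma dext_exists :
  (forall p, coefs_in E p -> p.[z] = 0 -> dext p = 0) ->
  exists D', [/\ derivation (adj E z) D', forall x, E x -> D' x = u * D x
    & D' z = xi].
Proof.
move=> wd.
have wd2 p q : coefs_in E p -> coefs_in E q -> p.[z] = q.[z] -> dext p = dext q.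
  move=> hp hq pq; have hN := coefs_inN hE hq.
  have: dext (p - q) = 0.
    by apply: wd; [exact: (coefs_inB hE)|rewrite hornerD hornerN pq subrr].
  rewrite dextD // => /eqP; rewrite addr_eq0 => /eqP->.
  have /eqP := dextD hq hN; rewrite subrr -polyC0 dextC der0 mulr0 eq_sym.
  by rewrite addr_eq0 => /eqP->.
have /choice[D' D'E] : forall x, exists y, forall p, coefs_in E p ->
    x = p.[z] -> y = dext p.
  move=> x; have [[p hp xE]|nx] := pselect (adj E z x).
    by exists (dext p) => q hq; rewrite xE => /wd2; apply.
  by exists 0 => p hp xE; case: nx; exists p.
have {}D'E p : coefs_in E p -> D' p.[z] = dext p by move=> hp; exact: D'E.
exists D'; split.
- split=> _ _ [p hp ->] [q hq ->].
    by rewrite -hornerD !D'E ?dextD //; exact: (coefs_inD hE).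
  by rewrite -hornerM !D'E ?dextM //; exact: (coefs_inM hE).
- move=> x Ex; rewrite -[x in LHS](hornerC x z) D'E ?dextC //.
  exact: (coefs_in_polyC hE).
- rewrite -[z in LHS](hornerX z) D'E; last exact: (coefs_inX hE).
  rewrite -[X in dext X]mul1r dextMX -polyC1 dextC hornerC.
  have /eqP : D 1 = 0.
    have /eqP := derM hD (ksub1 hE) (ksub1 hE).
    by rewrite !mul1r -subr_eq0 opprD addNKr oppr_eq0 => /eqP.
  by move=> /eqP->; ring.
Qed.

End Extension.

Section Extend.
Variables (k : fieldType) (B : comNzRingType) (i : {rmorphism k -> B}).
Hypotheses (char0 : [pchar k] =i pred0) (domB : isdom B).
Variables (E : B -> Prop) (D : B -> B).
Hypotheses (hE : ksub i E) (hD : derivation E D).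

Lemma natk_neq0 n : n.+1%:R != 0 :> k.
Proof. by have /pcharf0P-> := char0. Qed.

Lemma natB_neq0 n : n.+1%:R != 0 :> B.
Proof. by rewrite -(rmorph_nat i) fmorph_eq0 natk_neq0. Qed.

Lemma dommul_neq0 (x y : B) : x != 0 -> y != 0 -> x * y != 0.
Proof. by move=> /eqP x0 /eqP y0; apply/eqP => /domB[]. Qed.

Lemma domexp_neq0 (x : B) n : x != 0 -> x ^+ n != 0.
Proof.
move=> x0; elim: n => [|n IHn]; first by rewrite expr0 oner_neq0.
by rewrite exprS dommul_neq0.
Qed.

Lemma der_transcendental z : trans E z ->
  exists D', [/\ derivation (adj E z) D', forall x, E x -> D' x = D x
    & D' z = 1].
Proof.
move=> tz.
have [|D' [D'1 D'2 D'3]] := @dext_exists _ _ i E D hE hD z 1 1.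
  move=> p hp /(tz _ hp) ->; rewrite -polyC0 (dextC hE hD).
  by rewrite (der0 hE hD) mulr0.
by exists D'; split=> // x /D'2; rewrite mul1r.
Qed.

(* The extension to an algebraic z has denominator G'(z), where G is a relation
   of least degree; multiplying by u = G'(z) keeps the values in B. *)
Lemma der_extend z : exists u D',
  [/\ u != 0, derivation (adj E z) D' & forall x, E x -> D' x = u * D x].
Proof.
have [tz|] := pselect (trans E z).
  have [D' [D'1 D'2 _]] := der_transcendental tz.
  by exists 1, D'; split=> [|//|x Ex]; rewrite ?oner_neq0 // mul1r D'2.
move=> /not_trans[p0 hp0].
pose P n := exists p : {poly B}, [/\ coefs_in E p, p.[z] = 0, p != 0 & size p = n].
have exP : exists n, `[< P n >].
  by case: hp0 => hp pz p_neq0; exists (size p0); apply/asboolP; exists p0.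
have [m /asboolP[G [hG Gz G0 sG]] mP] := ex_minnP exP.
have Gmin q : coefs_in E q -> q.[z] = 0 -> (size q < size G)%N -> q = 0.
  move=> hq qz sq; apply: contrapT => /eqP q0.
  have /mP : `[< P (size q) >] by apply/asboolP; exists q.
  by rewrite leqNgt -sG sq.
have hdG : coefs_in E G^`().
  by move=> n; rewrite coef_deriv -mulr_natl; apply: (ksubM hE) => //; exact: (ksub_nat hE).
have sG1 : (1 < size G)%N.
  rewrite ltnNge; apply/negP => /size1_polyC GC; move: Gz G0.
  by rewrite GC hornerC => ->; rewrite polyC0 eqxx.
(* If the derivative of [G] vanished at [z], it would be zero by minimality; but its top coefficient
   is deg G times that of [G], nonzero in characteristic 0. *)
have dG0 : G^`().[z] != 0.
  apply/eqP => dz; have /(Gmin _ hdG dz) : (size G^`() < size G)%N.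
    by apply: lt_size_deriv.
  move/(congr1 (fun q : {poly B} => q`_(size G).-2)); rewrite coef_deriv coef0 => /eqP.
  rewrite -mulr_natl; apply/negP/dommul_neq0; first exact: natB_neq0.
  by rewrite prednK ?lead_coef_eq0 //; case: (size G) sG1 => [|[]].
pose u := G^`().[z]; pose xi := - (map_poly D G).[z].
have dextG : dext D z u xi G = 0 by rewrite /dext /u /xi; ring.
have [|D' [D'1 D'2 _]] := @dext_exists _ _ i E D hE hD z u xi; last by exists u, D'.
have dE := dextCM hE hD; have hC := coefs_in_polyC hE.
suff: forall n (p : {poly B}), (size p <= n)%N -> coefs_in E p -> p.[z] = 0 -> dext D z u xi p = 0.
  by move=> h p; apply: (h (size p)).
elim=> [p|n IHn p sp hp pz].
  rewrite leqn0 size_poly_eq0 => /eqP-> _ _.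
  by rewrite -polyC0 (dextC hE hD) (der0 hE hD) mulr0.
have [sGp|/Gmin-> //] := leqP (size G) (size p); last first.
  by rewrite -polyC0 (dextC hE hD) (der0 hE hD) mulr0.
(* Pseudo-division by [G]: [p] is scaled by the leading coefficient of [G] before its top term is
   cancelled, and the scalar is removed at the end because [B] is a domain. *)
pose r := (lead_coef G)%:P * p - (lead_coef p)%:P * ('X^(size p - size G) * G).
have Ea : E (lead_coef G) by exact: hG.
have Eb : E (lead_coef p) by exact: hp.
have hX : coefs_in E ('X^(size p - size G) * G).
  by apply: (coefs_inM hE) => //; apply: (coefs_inXn hE); apply: (coefs_inX hE).
have h1 : coefs_in E ((lead_coef G)%:P * p) by apply: (coefs_inM hE) => //; apply: hC.
have h2 : coefs_in E ((lead_coef p)%:P * ('X^(size p - size G) * G)).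
  by apply: (coefs_inM hE) => //; apply: hC.
have hr : coefs_in E r by exact: (coefs_inB hE).
have sp0 : (0 < size p)%N by apply: leq_trans sGp; apply: ltn_trans sG1.
have sr : (size r <= n)%N.
  apply/leq_sizeP => j nj; rewrite coefB !coefCM coefXnM.
  have [jlt|jge] := ltnP j (size p).-1.
    by move: (leq_ltn_trans nj jlt); rewrite -ltnS prednK // ltnNge sp.
  have lt1 : (j < size p - size G)%N = false.
    by apply/negbTE; rewrite -leqNgt; apply: leq_trans jge;
      rewrite -subn1 leq_sub2l // (ltn_trans _ sG1).
  rewrite lt1; have [->|jn] := eqVneq j (size p).-1.
    have -> : ((size p).-1 - (size p - size G) = (size G).-1)%N.
      rewrite -(subn1 (size p)) -subnDA addnC subnDA subKn // subn1 //.
    by rewrite -!lead_coefE mulrC subrr.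
  have jp : (size p <= j)%N by rewrite -(prednK sp0) ltn_neqAle eq_sym jn.
  rewrite [p`_j]nth_default // mulr0 nth_default ?mulr0 ?subrr //.
  by rewrite leq_subRL ?subnK //; apply: leq_trans jp; apply: leq_subr.
have rz : r.[z] = 0 by rewrite hornerD hornerN !hornerM pz Gz !mulr0 subr0.
have d2 : dext D z u xi ((lead_coef p)%:P * ('X^(size p - size G) * G)) = 0.
  have hXn : coefs_in E 'X^(size p - size G).
    by apply: (coefs_inXn hE); apply: (coefs_inX hE).
  by rewrite dE // (dextM hE hD) // dextG hornerM Gz !(mulr0,mul0r,addr0).
have : dext D z u xi (r + (lead_coef p)%:P * ('X^(size p - size G) * G)) = 0.
  by rewrite (dextD hE hD) // d2 IHn // addr0.
rewrite subrK dE // pz mulr0 addr0 => /domB[/eqP|//].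
by rewrite lead_coef_eq0 (negbTE G0).
Qed.
End Extend.

Section DomainKernel.
Variables (B : comNzRingType) (domB : isdom B).

(** Units and inverses are chosen classically, only to equip [B] with the integral domain structure
    that [det0P] requires. *)
Definition dom_unit : pred B := fun x => `[< exists y, y * x = 1 >].

Definition dom_inv (x : B) : B :=
  if pselect (exists y, y * x = 1) is left h then projT1 (cid h) else x.

Lemma dom_mulVr : {in dom_unit, left_inverse 1 dom_inv *%R}.
Proof.
move=> x /asboolP hx; rewrite /dom_inv; case: pselect => // h.
by case: (cid h).
Qed.

Lemma dom_unitP (x y : B) : y * x = 1 -> dom_unit x.
Proof. by move=> yx; apply/asboolP; exists y. Qed.

Lemma dom_inv_out : {in [predC dom_unit], dom_inv =1 id}.
Proof.
move=> x; rewrite inE /= => /asboolP hx.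
by rewrite /dom_inv; case: pselect.
Qed.

Lemma dom_integral : GRing.integral_domain_axiom B.
Proof. by move=> x y /domB[->|->]; rewrite eqxx ?orbT. Qed.

Definition dom_unitring : comUnitRingType := HB.pack_for comUnitRingType
  (GRing.ComNzRing.sort B)
  (GRing.ComNzRing_hasMulInverse.Build B dom_mulVr dom_unitP dom_inv_out).

Definition dom_idomain : idomainType := HB.pack_for idomainType
  (GRing.ComUnitRing.sort dom_unitring)
  (GRing.ComUnitRing_isIntegral.Build dom_unitring dom_integral).

Lemma dom_left_kernel n (M : 'M[B]_n) (b : 'I_n) : (forall a, M a b = 0) ->
  exists2 v : 'rV[B]_n, v != 0 & v *m M = 0.
Proof.
move=> Mb; have d0 : \det M = 0.
  by rewrite (expand_det_col M b) big1 // => a _; rewrite Mb mul0r.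
have /det0P := introT eqP (d0 : \det (M : 'M[dom_idomain]_n) = 0).
by [].
Qed.
End DomainKernel.

(** * Counting independent elements by derivations *)

Section RankBound.
Variables (k : fieldType) (B : comNzRingType) (i : {rmorphism k -> B}).
Hypotheses (char0 : [pchar k] =i pred0) (domB : isdom B).
Implicit Types (E : B -> Prop) (D : B -> B) (gs xs ys : seq B).

Let full (_ : B) := True.

Lemma der_extend_list gs E D : ksub i E -> derivation E D ->
  exists u D' F, [/\ u != 0, ksub i F /\ derivation F D',
    forall x, E x -> F x /\ D' x = u * D x & forall x, x \in gs -> F x].
Proof.
move=> hE hD; elim: gs => [|g gs [u [D' [F [u0 [hF hD'] EF gF]]]]].
  by exists 1, D, E; split=> // [|x Ex]; rewrite ?oner_neq0 ?mul1r.
have [w [D2 [w0 hD2 D2E]]] := der_extend char0 domB hF hD' g.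
exists (w * u), D2, (adj F g); split.
- exact: dommul_neq0.
- by split=> //; exact: ksub_adj.
- move=> x /EF[Fx D'x]; rewrite D2E // D'x mulrA; split=> //.
  exact: (sub_adj hF).
- move=> x; rewrite inE => /orP[/eqP->|/gF Fx]; first exact: (adj_gen hF).
  exact: (sub_adj hF).
Qed.

(** The zero derivation on the tower is extended by z -> 1, then to each generator in turn. The
    denominators gather into one nonzero factor [u], so the value at [z] stays nonzero. *)
Lemma der_separating gs s z : kgenerated i gs -> trans (gens i s) z ->
  exists D, [/\ derivation full D, forall x, gens i s x -> D x = 0 & D z != 0].
Proof.
move=> hgs tz; have hs := ksub_gens i s.
have d0 : derivation (gens i s) (fun=> 0).
  by split=> x y _ _; rewrite ?mulr0 addr0.
have [D [hD D0 Dz]] := der_transcendental hs d0 tz.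
have [u [D' [F [u0 [hF hD'] EF gF]]]] :=
  der_extend_list gs (ksub_adj hs z) hD.
have allF : forall x, F x by exact: hgs.
exists D'; split.
- by split=> x y _ _; [apply: (derD hD')|apply: (derM hD')].
- move=> x sx; have [|_ ->] := EF x; first exact: (sub_adj hs).
  by rewrite D0 // mulr0.
- have [|_ ->] := EF z; first exact: (adj_gen hs).
  by rewrite Dz mulr1.
Qed.

Lemma indep_nth xs n : indep i xs -> (n < size xs)%N ->
  trans (gens i (drop n.+1 xs)) xs`_n.
Proof.
elim: xs n => [//|x xs IHxs] [|n] /= [tx ixs] ltn; first by rewrite drop0.
exact: IHxs.
Qed.

(** The derivation [D a] kills the elements of [xs] after the a-th, but not the a-th. With fewer
    [ys] than [xs], a nontrivial combination of these derivations kills [ys], hence is zero; yet at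
    the element of largest index in its support it is not. *)
Lemma rank_bound gs ys xs : kgenerated i gs ->
  (forall D, derivation full D -> (forall c, D (i c) = 0) ->
     (forall y, y \in ys -> D y = 0) -> forall x, D x = 0) ->
  indep i xs -> (size xs <= size ys)%N.
Proof.
move=> hgs kill ixs; rewrite leqNgt; apply/negP => lt_yx.
have h (a : 'I_(size xs)) := der_separating hgs (indep_nth ixs (ltn_ord a)).
have {h}/choice[D hD] := h.
(* The matrix is made square by reading [ys] past its end: the default value 0 gives zero columns
   there, hence a left kernel. *)
pose M : 'M[B]_(size xs) := \matrix_(a, b) D a ys`_b.
have D0 a : D a 0 = 0.
  have [_ h _] := hD a; apply: h; exact: (ksub0 (ksub_gens i _)).
have [a|v v0 vM] := @dom_left_kernel B domB _ M (Ordinal lt_yx).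
  by rewrite mxE nth_default.
pose Dv x := \sum_a v 0 a * D a x.
have hDv : derivation full Dv.
  split=> x y _ _; rewrite /Dv.
    rewrite -big_split /=; apply: eq_bigr => a _.
    by have [hDa _ _] := hD a; rewrite (derD hDa) // mulrDr.
  rewrite !mulr_sumr -big_split /=; apply: eq_bigr => a _.
  by have [hDa _ _] := hD a; rewrite (derM hDa) //; ring.
have Dv0 : forall x, Dv x = 0.
  apply: kill => // [c|y /(nthP 0)[b lt_b <-]].
    apply: big1 => a _; have [_ Da0 _] := hD a; rewrite Da0 ?mulr0 //.
    exact: (ksubC (ksub_gens i _)).
  have := congr1 (fun w : 'rV_ _ => w 0 (Ordinal (ltn_trans lt_b lt_yx))) vM.
  rewrite !mxE => vMb; rewrite -[RHS]vMb.
  by apply: eq_bigr => a _; rewrite mxE.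
have [a0 va0] : exists a, v 0 a != 0.
  apply: contrapT => h; move/eqP: v0; apply; apply/rowP => a; rewrite mxE.
  by apply: contrapT => /eqP va; apply: h; exists a.
have [a va amax] := @arg_maxnP _ a0 (fun a => v 0 a != 0) (fun a => nat_of_ord a) va0.
have : v 0 a * D a xs`_a != 0 by apply: dommul_neq0 => //; have [] := hD a.
suff DvE : Dv xs`_a = v 0 a * D a xs`_a by rewrite -DvE Dv0 eqxx.
rewrite /Dv (bigD1 a) //= big1 ?addr0 // => b ba.
have [lt_ba|lt_ab|/val_inj eq_ab] := ltngtP b a; last by rewrite eq_ab eqxx in ba.
  have [_ Db0 _] := hD b; rewrite Db0 ?mulr0 //.
  apply: gens_mem; rewrite -(subnKC lt_ba) -nth_drop mem_nth // size_drop.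
  by rewrite ltn_sub2r // (leq_ltn_trans lt_ba).
have [->|/amax/=] := eqVneq (v 0 b) 0; first by rewrite mul0r.
by rewrite leqNgt lt_ab.
Qed.
End RankBound.

(** * Chains of prime ideals *)

Section PowerIndependence.
Variables (k : fieldType) (B : comNzRingType) (i : {rmorphism k -> B}).
Hypothesis char0 : [pchar k] =i pred0.

Lemma expz2_inj (m n : int) : 2%:R ^ m = 2%:R ^ n :> k -> m = n.
Proof.
have n2 : 2%:R != 0 :> k by exact: natk_neq0.
have nat0 (d : nat) : 2%:R ^+ d = 1 :> k -> d = 0%N.
  move=> /eqP; rewrite -natrX; case: d => // d.
  rewrite -(@prednK (2 ^ d.+1)) ?expn_gt0 // -addn1 natrD -subr_eq0 addrK.
  have /pcharf0P-> := char0; rewrite -subn1 subn_eq0.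
  by rewrite leqNgt -{1}(expn0 2) ltn_exp2l.
have int0 (d : int) : 2%:R ^ d = 1 :> k -> d = 0.
  case: d => d; first by rewrite -exprnP => /nat0->.
  by rewrite NegzE -exprnN -[RHS]invr1 => /invr_inj/nat0.
move=> eq_mn; apply/eqP; rewrite -subr_eq0; apply/eqP/int0.
by rewrite expfzDr // -invr_expz eq_mn divff // expfz_neq0.
Qed.

(* In characteristic 0 the powers of 2 are distinct, so combining the relations
   at z and at 2z eliminates one exponent. *)
Lemma power_indep (e : seq int) (b : int -> B) : uniq e ->
  (forall z, z != 0 -> \sum_(m <- e) i (z ^ m) * b m = 0) ->
  forall m, m \in e -> b m = 0.
Proof.
have n2 : 2%:R != 0 :> k by exact: natk_neq0.
elim: e b => [//|m e IHe] b /= /andP[me ue] h.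
have be n : n \in e -> b n = 0.
  move=> ne; have h0 : i (2%:R ^ n - 2%:R ^ m) * b n = 0.
    apply: (IHe (fun n => i (2%:R ^ n - 2%:R ^ m) * b n)) => // z z0.
    have /eqP := h (2%:R * z) (mulf_neq0 n2 z0); rewrite -subr_eq0.
    have {2}<- : i (2%:R ^ m) * \sum_(n <- m :: e) i (z ^ n) * b n = 0.
      by rewrite h // mulr0.
    rewrite !big_cons [X in _ - X]mulrDr opprD addrACA mulrA -rmorphM -expfzMl.
    rewrite subrr add0r mulr_sumr -sumrB => /eqP hz; rewrite -[RHS]hz; apply: eq_bigr => l _.
    by rewrite expfzMl rmorphM rmorphB; ring.
  have c0 : 2%:R ^ n - 2%:R ^ m != 0 :> k.
    rewrite subr_eq0; apply/eqP => /expz2_inj nm; by rewrite -nm ne in me.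
  rewrite -[b n]mul1r -(rmorph1 i) -(mulVf c0) rmorphM -mulrA h0.
  by rewrite mulr0.
move=> n; rewrite inE => /orP[/eqP->|/be//].
have := h 1 (oner_neq0 _); rewrite big_cons exp1rz rmorph1 mul1r.
by rewrite big_seq big1 ?addr0 // => l /be ->; rewrite mulr0.
Qed.

Lemma poly_nonroot (p : {poly B}) : p != 0 -> exists c, p.[i c] != 0.
Proof.
move=> p0; apply: contrapT => h; move/eqP: p0; apply; apply/polyP => j.
rewrite coef0; have [lt_j|/(nth_default 0)//] := ltnP j (size p).
have := @power_indep [seq Posz n | n <- iota 0 (size p)] (fun m => p`_`|m|%N).
move=> /(_ _ _ (Posz j))/=; apply.
- by rewrite map_inj_uniq ?iota_uniq // => a b [].
- move=> z z0; rewrite big_map; apply: contrapT => /eqP hz; apply: h.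
  exists z; rewrite horner_coef -(big_mkord xpredT (fun j => p`_j * i z ^+ j)).
  rewrite /index_iota subn0; move: hz; congr (_ != _).
  by apply: eq_bigr => l _; rewrite -rmorphXn mulrC.
- by rewrite map_f // mem_iota.
Qed.
End PowerIndependence.

Section PrimeIdeal.
Variables (B : comNzRingType) (P : {pred B}).
Hypothesis hP : prime_ideal P.
Implicit Types x y : B.

Lemma prime0 : 0 \in P. Proof. by case: hP => -[]. Qed.
Lemma prime1 : 1 \notin P. Proof. by case: hP => -[]. Qed.
Lemma primeMl x y : y \in P -> x * y \in P.
Proof.
case: hP => -[P0 _ h] _ Py; rewrite -[_ * _]addr0; exact: h.
Qed.
Lemma primeD x y : x \in P -> y \in P -> x + y \in P.
Proof. by case: hP => -[P0 _ h] _ Px Py; rewrite -[x]mul1r; apply: h. Qed.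
Lemma primeN x : x \in P -> - x \in P.
Proof. by move=> Px; rewrite -mulN1r primeMl. Qed.
Lemma primeB x y : x \in P -> y \in P -> x - y \in P.
Proof. by move=> Px Py; rewrite primeD // primeN. Qed.
Lemma primeM x y : x * y \in P -> x \in P \/ y \in P.
Proof. by case: hP => _ h /h/orP. Qed.
Lemma prime_sum (I : Type) (r : seq I) (Q : pred I) (f : I -> B) :
  (forall j, Q j -> f j \in P) -> \sum_(j <- r | Q j) f j \in P.
Proof.
by move=> h; apply: (big_ind (fun x => x \in P)) => //; [exact: prime0|exact: primeD].
Qed.
Lemma prime_congrM x x' y y' : x - x' \in P -> y - y' \in P ->
  x * y - x' * y' \in P.
Proof.
move=> hx hy; have -> : x * y - x' * y' = x * (y - y') + y' * (x - x') by ring.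
by rewrite primeD // primeMl.
Qed.
Lemma prime_congrX x x' n : x - x' \in P -> x ^+ n - x' ^+ n \in P.
Proof. by move=> hx; rewrite subrXX mulrC primeMl. Qed.
Lemma prime_congrD x x' y y' : x - x' \in P -> y - y' \in P ->
  x + y - (x' + y') \in P.
Proof. by move=> hx hy; rewrite opprD addrACA primeD. Qed.
Lemma prime_congr_sum (I : Type) (r : seq I) (f g : I -> B) :
  (forall j, f j - g j \in P) ->
  \sum_(j <- r) f j - \sum_(j <- r) g j \in P.
Proof. by move=> h; rewrite -sumrB; apply: prime_sum. Qed.
End PrimeIdeal.

Lemma prime_avoiding (B : comNzRingType) (J T : B -> Prop) :
  J 0 -> (forall a u v, J u -> J v -> J (a * u + v)) ->
  T 1 -> (forall x y, T x -> T y -> T (x * y)) ->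
  (forall x, J x -> ~ T x) ->
  exists P : {pred B}, [/\ prime_ideal P, forall x, J x -> x \in P
    & forall x, x \in P -> ~ T x].
Proof.
move=> J0 Jlin T1 TM JT.
pose good (X : B -> Prop) := [/\ forall x, J x -> X x,
  forall a u v, X u -> X v -> X (a * u + v) & forall x, X x -> ~ T x].
have goodJ : good J by [].
pose Z : classical_sets.set (classical_sets.set B) :=
  fun X => (forall x, ~ X x) \/ good X.
have [F FZ Ftot|A [ZA Amax]] := @classical_sets.Zorn_bigcup B Z.
  have [nF|eF] := pselect (exists2 X, F X & exists x, X x); last first.
    by left=> x [X FX Xx]; apply: eF; exists X => //; exists x.
  case: nF => X FX [x Xx]; right.
  have goodF Y y : F Y -> Y y -> good Y by move=> /FZ[h /h|].
  have [JX _ _] := goodF _ _ FX Xx.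
  split=> [y Jy|a u v [Y FY Yu] [Y' FY' Yv]|y [Y FY Yy]].
  - by exists X => //; apply: JX.
  - have [sY|sY] := Ftot _ _ FY FY'.
      have [_ h _] := goodF _ _ FY' Yv; exists Y' => //.
      by apply: h => //; apply: sY.
    have [_ h _] := goodF _ _ FY Yu; exists Y => //.
    by apply: h => //; apply: sY.
  - by have [_ _] := goodF _ _ FY Yy; apply.
have notsub (X : B -> Prop) : good X -> (forall x, A x -> X x) ->
    forall x, X x -> A x.
  move=> gX AX x Xx; apply: contrapT => nAx; apply: (Amax X); last by right.
  by split=> // h; apply: nAx; exact: h.
have gA : good A.
  case: ZA => // A0; suff Jx : A 0 by case: (A0 0).
  by apply: (notsub _ goodJ) => // x /A0.
have [JA Alin AT] := gA.
have A00 : A 0 by apply: JA.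
exists (fun x => `[< A x >]); split; last 2 first.
- by move=> x Jx; apply/asboolP/JA.
- by move=> x /asboolP/AT.
split; first split.
- exact/asboolP.
- by apply/asboolP => /AT; apply.
- by move=> a u v /asboolP Au /asboolP Av; apply/asboolP/Alin.
move=> u v /asboolP Auv; apply/orP.
(* The ideal generated by [A] and [w]. If neither [u] nor [v] is in [A], maximality makes both
   enlarged ideals meet [T], and the product of the two elements found lies in [A] because [u * v]
   does. *)
pose ext w x := exists a b, A a /\ x = a + b * w.
have extA w : ~ A w -> exists2 x, ext w x & T x.
  move=> nAw; apply: contrapT => h; apply: nAw; apply: (notsub (ext w)).
  - split=> [x Jx|a x y [a1 [b1 [A1 ->]]] [a2 [b2 [A2 ->]]]|x ex Tx].
    + by exists x, 0; split; [exact: JA|rewrite mul0r addr0].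
    + by exists (a * a1 + a2), (a * b1 + b2); split; [exact: Alin|ring].
    + by apply: h; exists x.
  - by move=> x Ax; exists x, 0; split=> //; rewrite mul0r addr0.
  - by exists 0, 1; split=> //; rewrite mul1r add0r.
have [Au|/extA[x [a [b [Aa ->]]] Tx]] := pselect (A u).
  by left; apply/asboolP.
have [Av|/extA[y [a' [b' [Aa' ->]]] Ty]] := pselect (A v).
  by right; apply/asboolP.
suff Axy : A ((a + b * u) * (a' + b' * v)) by case: (AT _ Axy (TM _ _ Tx Ty)).
have -> : (a + b * u) * (a' + b' * v) =
    (b' * v + a') * a + (b * u * a' + (b * b' * (u * v) + 0)) by ring.
by apply: (Alin) => //; apply: (Alin) => //; apply: (Alin).
Qed.

Section PrimeChains.
Variables (k : fieldType) (B : comNzRingType) (i : {rmorphism k -> B}).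

Lemma prime_scalar (P : {pred B}) c : prime_ideal P -> i c \in P -> c = 0.
Proof.
move=> hP Pc; apply/eqP; apply: contraT => c0.
have := primeMl hP (i c^-1) Pc; rewrite -rmorphM mulVf // rmorph1.
by rewrite (negbTE (prime1 hP)).
Qed.

(** Elements are picked from the top of the chain downwards, keeping the invariant that the algebra
    generated so far meets [p (m - n)] only in 0. In a relation of the next element [x], the
    constant term lies in that prime, hence is 0; then [x] is cancelled modulo the next smaller
    prime. *)
Lemma prime_chain_indep m (p : nat -> {pred B}) : prime_chain m p ->
  exists2 xs, size xs = m & indep i xs.
Proof.
move=> [hp sp].
suff h n : (n <= m)%N -> exists xs, [/\ size xs = n, indep i xs
    & forall y, gens i xs y -> y \in p (m - n)%N -> y = 0].
  by have [xs [sxs ixs _]] := h m (leqnn m); exists xs.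
elim: n => [_|n IHn lt_nm].
  exists [::]; split=> // _ [c ->] hc.
  by rewrite (@prime_scalar _ c (hp _ (leq_subr _ _)) hc) rmorph0.
have [xs [sxs ixs xsP]] := IHn (ltnW lt_nm).
have lt_j : (m - n.+1 < m)%N by rewrite ltn_subrL (leq_ltn_trans _ lt_nm).
have [] := sp _ lt_j; rewrite subnSK // => pp [x px npx].
have hpj := hp _ (ltnW lt_j); have hpj1 := hp _ (leq_subr n m).
have key q : coefs_in (gens i xs) q -> q.[x] \in p (m - n.+1)%N -> q = 0.
  elim/poly_ind: q => [//|q c IHq /coefs_in_cons[hq Ec]].
  rewrite hornerD hornerM hornerX hornerC => hqc.
  have c0 : c = 0.
    apply: xsP => //; rewrite -[c](addKr (q.[x] * x)) addrC.
    by rewrite primeB //; [exact: pp|rewrite primeMl].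
  have /(primeM hpj)[/(IHq hq)->|] : q.[x] * x \in p (m - n.+1)%N.
  - by move: hqc; rewrite c0 addr0.
  - by rewrite c0 mul0r addr0.
  - by rewrite (negbTE npx).
exists (x :: xs); split=> /=; first by rewrite sxs.
  by split=> // q hq qx; apply: key => //; rewrite qx; exact: prime0.
by move=> _ [q hq ->] /(key _ hq)->; rewrite horner0.
Qed.

Hypotheses (char0 : [pchar k] =i pred0) (domB : isdom B).

(* Going up along f - c, for a point c where the denominator g does not vanish:
   f - c stays a nonunit modulo P on the nonzero elements of the smaller tower,
   because B is integral over gens (f :: s) after inverting g. *)
Lemma prime_chain_from s (P : {pred B}) g : prime_ideal P -> indep i s ->
  (forall x, gens i s x -> x \in P -> x = 0) -> gens i s g -> g != 0 ->
  (forall x, exists M N (a : nat -> B), (forall j, gens i s (a j)) /\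
     (g ^+ M * x) ^+ N + \sum_(j < N) a j * (g ^+ M * x) ^+ j \in P) ->
  exists2 p, prime_chain (size s) p & p 0%N = P.
Proof.
elim: s P g => [|f s IHs] P g hP.
  by move=> _ _ _ _ _; exists (fun=> P) => //; split.
move=> /= [tf is_] sP [pg hpg gE] g0 hint; have hs := ksub_gens i s.
have hs' := ksub_adj hs f.
have pg0 : pg != 0 by apply: contraNneq g0 => pg0; rewrite gE pg0 horner0.
have [c gc0] := poly_nonroot i char0 pg0; set gc := pg.[i c] in gc0.
have sc : gens i s (i c) by exact: (ksubC hs).
have hXc : coefs_in (gens i s) ('X - (i c)%:P).
  by apply: (coefs_inB hs); [exact: (coefs_inX hs)|exact: (coefs_in_polyC hs)].
pose h := f - i c; have hE : h = ('X - (i c)%:P).[f].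
  by rewrite hornerD hornerN hornerX hornerC.
have nPh : h \notin P.
  apply/negP => Ph; have h0 : h = 0.
    by apply: sP => //; rewrite hE; exists ('X - (i c)%:P).
  have /eqP := tf _ hXc (etrans (esym hE) h0).
  by rewrite polyXsubC_eq0.
have [A hA] : exists A : (nat -> B) -> nat -> {poly B}, forall a,
    (forall j, adj (gens i s) f (a j)) ->
    forall j, coefs_in (gens i s) (A a j) /\ a j = (A a j).[f].
  have /choice[A hA] : forall a : nat -> B, exists Aa : nat -> {poly B},
      (forall j, adj (gens i s) f (a j)) ->
      forall j, coefs_in (gens i s) (Aa j) /\ a j = (Aa j).[f].
    move=> a; have [ha|] := pselect (forall j, adj (gens i s) f (a j)).
      have /choice[Aa hAa] : forall j, exists q, coefs_in (gens i s) q /\ a j = q.[f].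
        by move=> j; have [q hq ->] := ha j; exists q.
      by exists Aa.
    by exists (fun=> 0).
  by exists A.
pose J x := exists q b, q \in P /\ x = q + h * b.
pose T x := gens i s x /\ x != 0.
have [||||x [q [b [Pq xE]]] [sx x0]|P' [hP' JP' P'T]] := @prime_avoiding B J T.
- by exists 0, 0; split; [exact: prime0|rewrite mulr0 addr0].
- move=> a _ _ [q [b [Pq ->]]] [q' [b' [Pq' ->]]].
  exists (a * q + q'), (a * b + b'); split; last by ring.
  by rewrite primeD // primeMl.
- by split; [exact: (ksub1 hs)|exact: oner_neq0].
- move=> x y [sx x0] [sy y0]; split; first exact: (ksubM hs).
  exact: dommul_neq0.
- have [M [N [a [ha rel]]]] := hint b; have {hA}hAa := hA a ha.
  pose y := pg ^+ M * x%:P.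
  have hy : coefs_in (gens i s) y.
    by apply: (coefs_inM hs); [exact: (coefs_inXn hs)|exact: (coefs_in_polyC hs)].
  (* Modulo [P], [y.[f]] is [h * (g ^+ M * b)], so the integral equation of [b] times [h ^+ N] says
     [W.[f] \in P], whence [W = 0]. At [i c] the powers of ['X - (i c)%:P] kill all terms but the
     first, so a power of the nonzero [gc ^+ M * x] would vanish. *)
  pose W := y ^+ N + \sum_(j < N) A a j * ('X - (i c)%:P) ^+ (N - j) * y ^+ j.
  have hW : coefs_in (gens i s) W.
    apply: (coefs_inD hs); first exact: (coefs_inXn hs).
    apply: (big_ind (coefs_in (gens i s))) => [||j _].
    - by rewrite -polyC0; apply: (coefs_in_polyC hs); exact: (ksub0 hs).
    - exact: (coefs_inD hs).
    - apply: (coefs_inM hs); last exact: (coefs_inXn hs).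
      by apply: (coefs_inM hs); [have [] := hAa j|exact: (coefs_inXn hs)].
  have Wf : W.[f] \in P.
    have yf : h * (g ^+ M * b) - y.[f] \in P.
      rewrite hornerM horner_exp -gE hornerC xE.
      have -> : h * (g ^+ M * b) - g ^+ M * (q + h * b) = - g ^+ M * q by ring.
      exact: primeMl.
    set w := (X in X \in P) in rel.
    suff hw : h ^+ N * w - W.[f] \in P.
      by rewrite -[W.[f]](subKr (h ^+ N * w)) primeB // primeMl.
    rewrite /W hornerD horner_sum mulrDr mulr_sumr.
    apply: prime_congrD => //; first by rewrite -exprMn horner_exp prime_congrX.
    apply: prime_congr_sum => // j.
    have [_ {1}->] := hAa j; rewrite !hornerM !horner_exp -hE.
    rewrite -{1}(subnK (ltnW (ltn_ord j))) exprD.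
    have -> : h ^+ (N - j) * h ^+ j * ((A a j).[f] * (g ^+ M * b) ^+ j) =
      (A a j).[f] * h ^+ (N - j) * (h * (g ^+ M * b)) ^+ j by rewrite !exprMn; ring.
    by rewrite -mulrBr primeMl // prime_congrX.
  have W0 : W = 0 by apply: tf => //; apply: sP => //; exists W.
  have : W.[i c] = 0 by rewrite W0 horner0.
  rewrite hornerD horner_sum big1 => [|j _]; last first.
    rewrite !hornerM !horner_exp hornerD hornerN hornerX hornerC subrr.
    by rewrite expr0n subn_eq0 leqNgt ltn_ord mulr0 mul0r.
  rewrite addr0 horner_exp hornerM horner_exp hornerC => /eqP; apply/negP.
  by do 2?[apply: domexp_neq0 || apply: dommul_neq0] => //; apply: domexp_neq0.
have PP' x : x \in P -> x \in P'.
  by move=> Px; apply: JP'; exists x, 0; split=> //; rewrite mulr0 addr0.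
have P'h : h \in P'.
  by apply: JP'; exists 0, 1; split; [exact: prime0|rewrite mulr1 add0r].
(* Since [f] and [i c] agree modulo [P'], the integral equations specialize to the shorter tower,
   with [gc] in place of [g]. *)
have congrfc (q : {poly B}) : q.[f] - q.[i c] \in P'.
  rewrite !horner_coef; apply: prime_congr_sum => // j.
  by rewrite -mulrBr primeMl // prime_congrX.
have [| | | |p hp p0] := IHs P' gc hP' is_.
- by move=> x sx P'x; apply: contrapT => /eqP x0; apply: (P'T x).
- exact: (coefs_in_horner hs).
- exact: gc0.
- move=> x; have [M [N [a [ha rel]]]] := hint x; have {hA}hAa := hA a ha.
  exists M, N, (fun j => (A a j).[i c]); split.
    by move=> j; apply: (coefs_in_horner hs) => //; have [] := hAa j.
  have gM : g ^+ M * x - gc ^+ M * x \in P'.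
    rewrite -mulrBl mulrC primeMl // prime_congrX //.
    by rewrite gE; exact: congrfc.
  set w := (X in X \in P'); set w0 := (X in X \in P) in rel.
  suff ww : w0 - w \in P'.
    by rewrite -[w]opprK -[- w](addKr w0) opprD opprK primeB // PP'.
  apply: prime_congrD => //; first exact: prime_congrX.
  apply: prime_congr_sum => // j; apply: prime_congrM => //.
    by have [_ ->] := hAa j; exact: congrfc.
  exact: prime_congrX.
exists (fun n => if n is n'.+1 then p n' else P) => //.
case: hp => hp1 hp2; split=> [[|n] ltn|[|n] ltn] //.
- exact: hp1.
- by rewrite p0; split=> //; exists h.
- exact: hp2.
Qed.
End PrimeChains.

(** * Integrality over a tower after inverting one element *)

Section Denominators.
Variables (k : fieldType) (B : comNzRingType) (i : {rmorphism k -> B}).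
Hypotheses (char0 : [pchar k] =i pred0) (domB : isdom B).

(* The base ring is an iterated polynomial ring, so that the integral closure
   results of mxpoly, stated for a ring morphism, apply to gens s. *)
Lemma gens_image s : exists (A : comNzRingType) (phi : {rmorphism A -> B}),
  forall x, gens i s x <-> exists a, x = phi a.
Proof.
elim: s => [|z s [A [phi hA]]]; first by exists k, i.
have cfu : commr_rmorph phi z by move=> a; exact: mulrC.
exists {poly A}, (horner_morph cfu) => x; split=> [[q hq ->]|[a ->]]; last first.
  exists (map_poly phi a) => // n; rewrite coef_map; apply/hA.
  by exists a`_n.
have /choice[a ha] : forall n, exists a, q`_n = phi a.
  by move=> n; apply/hA/hq.
exists (\poly_(j < size q) a j); rewrite /horner_morph /=; congr (_.[_]).
apply/polyP => n; rewrite coef_map /= coef_poly; case: ltnP => [_|hn].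
  exact: ha.
by rewrite rmorph0 nth_default.
Qed.

(** Multiplying a relation of degree n by [l ^+ n.-1] makes it monic in [l * z]; the coefficient of
    index j < n keeps the factor [l ^+ (n.-1 - j)]. *)
Lemma integral_lead (A : comNzRingType) (phi : {rmorphism A -> B}) z
    (p : {poly B}) : (forall n, exists a, p`_n = phi a) -> p.[z] = 0 ->
  p != 0 -> integralOver phi (lead_coef p * z).
Proof.
move=> /choice[a ha] pz p0; set l := lead_coef p.
pose n := (size p).-1; have sp : size p = n.+1 by rewrite prednK ?size_poly_gt0.
have n0 : (0 < n)%N.
  rewrite lt0n; apply/eqP => n0; move: sp pz p0; rewrite n0 => /eqP/size_poly1P[c c0 ->].
  by rewrite hornerC => /eqP; rewrite (negbTE c0).
pose q : {poly A} := 'X^n + \poly_(j < n) (a j * a n ^+ (n.-1 - j)).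
have sq : (size (\poly_(j < n) (a j * a n ^+ (n.-1 - j)))%R <= n)%N.
  exact: size_poly.
exists q.
  by rewrite monicE lead_coefDl ?lead_coefXn // size_polyXn ltnS.
rewrite /root rmorphD /= map_polyXn hornerD hornerXn.
have la : l = phi (a n) by rewrite -ha.
have -> : (map_poly phi (\poly_(j < n) (a j * a n ^+ (n.-1 - j)))).[l * z] =
    \sum_(j < n) p`_j * l ^+ (n.-1 - j) * (l * z) ^+ j.
  rewrite (@horner_coef_wide _ n); last exact: leq_trans (size_poly _ _) sq.
  apply: eq_bigr => j _; rewrite coef_map /= coef_poly ltn_ord rmorphM rmorphXn.
  by rewrite ha la.
have : l ^+ n.-1 * p.[z] = 0 by rewrite pz mulr0.
rewrite horner_coef sp big_ord_recr /= mulrDr mulr_sumr => h.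
rewrite -[X in _ == X]h addrC; apply/eqP; congr (_ + _).
  apply: eq_bigr => j _; rewrite exprMn.
  have jn : (j <= n.-1)%N by rewrite -ltnS prednK.
  by rewrite -{2}(subnK jn) exprD; ring.
rewrite exprMn -{1}(prednK n0) exprSr.
by rewrite (_ : p`_n = l) // /l lead_coefE sp; ring.
Qed.

(** The product [g] of the leading coefficients of relations of the generators makes [g] times each
    generator integral. A general [x] is a polynomial in the generators, so the power [M] depends on
    it. *)
Lemma common_denominator gs s : kgenerated i gs ->
  (forall x, x \in gs -> ~ trans (gens i s) x) ->
  exists2 g, gens i s g & g != 0 /\
  forall x, exists M N (a : nat -> B), (forall j, gens i s (a j)) /\
     (g ^+ M * x) ^+ N + \sum_(j < N) a j * (g ^+ M * x) ^+ j = 0.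
Proof.
move=> hgs alg; have hs := ksub_gens i s.
have [A [phi hA]] := gens_image s.
have intE x : gens i s x -> integralOver phi x.
  by move/hA=> [a ->]; exact: integral_id.
have [g sg [g0 gint]] : exists2 g, gens i s g & g != 0 /\
    forall x, x \in gs -> integralOver phi (g * x).
  elim: {hgs}gs alg => [|z gs IHgs] alg.
    by exists 1; [exact: (ksub1 hs)|split=> //; exact: oner_neq0].
  have [x xs|g sg [g0 gint]] := IHgs; first by apply: alg; rewrite inE xs orbT.
  have [p [hp pz p0]] := not_trans (alg z (mem_head _ _)).
  have sl : gens i s (lead_coef p) by exact: hp.
  have lint : integralOver phi (lead_coef p * z).
    by apply: integral_lead => // n; apply/hA; exact: hp.
  exists (lead_coef p * g); first exact: (ksubM hs).
  split; first by apply: dommul_neq0 => //; rewrite lead_coef_eq0.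
  move=> x; rewrite inE => /orP[/eqP->|xs].
    by rewrite (mulrC _ g) -mulrA; apply: integral_mul => //; exact: intE.
  by rewrite -mulrA; apply: integral_mul; [exact: intE|exact: gint].
exists g => //; split=> // x.
have gX n : integralOver phi (g ^+ n) by apply: intE; exact: (ksubX hs).
suff [M [p mp /eqP rp]] : exists M, integralOver phi (g ^+ M * x).
  have [N sN] : exists N, size p = N.+1.
    by exists (size p).-1; rewrite prednK // size_poly_gt0 monic_neq0.
  exists M, N, (fun j => phi p`_j); split.
    by move=> j; apply/hA; exists p`_j.
  rewrite -[RHS]rp horner_coef size_map_poly_id0; last first.
    by rewrite (monicP mp) rmorph1 oner_neq0.
  rewrite sN big_ord_recr /= addrC; congr (_ + _).
    rewrite coef_map /= -[X in p`_X]/(N.+1.-1) -sN -lead_coefE (monicP mp).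
    by rewrite rmorph1 mul1r.
  by apply: eq_bigr => j _; rewrite coef_map.
apply: (hgs (fun x => exists M, integralOver phi (g ^+ M * x))).
  split=> [c|y z [M hy] [N hz]|y z [M hy] [N hz]].
  - by exists 0%N; rewrite expr0 mul1r; apply: intE; exact: (ksubC hs).
  - exists (M + N)%N; have -> : g ^+ (M + N) * (y + z) =
      g ^+ N * (g ^+ M * y) + g ^+ M * (g ^+ N * z) by rewrite exprD; ring.
    by apply: integral_add; apply: integral_mul.
  - exists (M + N)%N; have -> : g ^+ (M + N) * (y * z) =
      (g ^+ M * y) * (g ^+ N * z) by rewrite exprD; ring.
    exact: integral_mul.
by move=> y /gint hy; exists 1%N; rewrite expr1.
Qed.

Lemma indep_extend (gs s : seq B) : indep i s -> exists s', [/\ indep i s',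
  (size s <= size s')%N & forall x, x \in gs -> ~ trans (gens i s') x].
Proof.
move=> is_; elim: gs => [|z gs [s' [is' ss' hs']]]; first by exists s.
have [tz|ntz] := pselect (trans (gens i s') z); last first.
  by exists s'; split=> // x; rewrite inE => /orP[/eqP->|/hs'].
exists (z :: s'); split=> //=; first exact: leqW.
have hz := ksub_gens i (z :: s').
move=> x; rewrite inE => /orP[/eqP-> tz'|/hs' ntx tx]; last first.
  by apply: ntx; apply: trans_sub tx; apply: (sub_adj (ksub_gens i s')).
have hX : coefs_in (adj (gens i s') z) ('X - z%:P).
  apply: (coefs_inB hz); first exact: (coefs_inX hz).
  by apply: (coefs_in_polyC hz); exact: (adj_gen (ksub_gens i s')).
have := polyXsubC_eq0 z; rewrite (tz' _ hX) ?eqxx //.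
by rewrite hornerD hornerN hornerX hornerC subrr.
Qed.

Lemma prime_chain_exists gs s : kgenerated i gs -> indep i s ->
  exists2 n, (size s <= n)%N & exists p, @prime_chain B n p.
Proof.
move=> hgs /(indep_extend gs)[s' [is' ss' alg]].
have [g sg [g0 hg]] := common_denominator hgs alg.
exists (size s') => //.
pose P : {pred B} := fun x => x == 0.
have PE x : (x \in P) = (x == 0) by [].
have hP : prime_ideal P.
  split; first split; rewrite ?PE ?eqxx ?oner_neq0 //.
    by move=> a u v; rewrite !PE => /eqP-> /eqP->; rewrite mulr0 addr0.
  by move=> u v; rewrite !PE => /eqP/domB[->|->]; rewrite eqxx ?orbT.
have [||||p hp _] := @prime_chain_from _ _ i char0 domB s' P g hP is'.
- by move=> x _; rewrite PE => /eqP.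
- exact: sg.
- exact: g0.
- move=> x; have [M [N [a [ha ha0]]]] := hg x.
  by exists M, N, a; split=> //; rewrite PE ha0.
by exists p.
Qed.
End Denominators.

(** * Ranks, group orders and valuations with independent values *)

Section ZSpan.
Variable V : zmodType.
Implicit Types (b : seq V) (x y : V).

(** The recursion mirrors [gens] and [indep], so that [val_indep] can treat a list of elements and
    the list of its values in one induction. *)
Fixpoint zspan b y : Prop :=
  if b is g :: b' then exists c : int, zspan b' (y - g *~ c) else y = 0.

Fixpoint zindep b : Prop :=
  if b is g :: b' then (forall c : int, zspan b' (g *~ c) -> c = 0) /\ zindep b'
  else True.

Lemma zspan0 b : zspan b 0.
Proof. by elim: b => [//|g b IHb] /=; exists 0; rewrite mulr0z subr0. Qed.

Lemma zspanD b x y : zspan b x -> zspan b y -> zspan b (x + y).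
Proof.
elim: b x y => [|g b IHb] x y /=; first by move=> -> ->; rewrite addr0.
move=> [c hc] [c' hc']; exists (c + c').
by rewrite mulrzDr opprD addrACA; exact: IHb.
Qed.

Lemma zspanZ b x (e : int) : zspan b x -> zspan b (x *~ e).
Proof.
elim: b x => [|g b IHb] x /=; first by move=> ->; rewrite mul0rz.
by move=> [c hc]; exists (c * e); rewrite mulrzA -mulrzBl; exact: IHb.
Qed.

Lemma zspanB b x y : zspan b x -> zspan b y -> zspan b (x - y).
Proof. by move=> hx hy; apply: zspanD => //; rewrite -mulrN1z; exact: zspanZ. Qed.

Lemma zspan_cons g b x : zspan b x -> zspan (g :: b) x.
Proof. by move=> hx; exists 0; rewrite mulr0z subr0. Qed.

Lemma zspan_mem b x : x \in b -> zspan b x.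
Proof.
elim: b => [//|g b IHb]; rewrite inE => /orP[/eqP->|/IHb]; last exact: zspan_cons.
by exists 1; rewrite mulr1z subrr; exact: zspan0.
Qed.

Lemma zspan_sum b (I : finType) (f : I -> V) (c : I -> int) :
  (forall j, zspan b (f j)) -> zspan b (\sum_j f j *~ c j).
Proof.
move=> h; apply: (big_ind (zspan b)) => [||j _].
- exact: zspan0.
- exact: zspanD.
- exact: zspanZ.
Qed.

Lemma zspan_coords b y : zspan b y ->
  exists c : nat -> int, y = \sum_(j < size b) b`_j *~ c j.
Proof.
elim: b y => [|g b IHb] y /=; first by move=> ->; exists (fun=> 0); rewrite big_ord0.
move=> [c0 /IHb[c hc]]; exists (fun n => if n is n'.+1 then c n' else c0).
by rewrite big_ord_recl /= -hc addrC subrK.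
Qed.

Lemma zindep_coords b (c : nat -> int) : zindep b ->
  \sum_(j < size b) b`_j *~ c j = 0 -> forall j, (j < size b)%N -> c j = 0.
Proof.
elim: b c => [//|g b IHb] c /= [hg hb]; rewrite big_ord_recl /= => h.
have s0 : zspan b (\sum_(j < size b) b`_j *~ c j.+1).
  by apply: zspan_sum => j; apply: zspan_mem; exact: mem_nth.
have c0 : c 0%N = 0.
  apply: hg; move/eqP: h; rewrite addr_eq0 => /eqP->.
  by rewrite -sub0r; apply: zspanB => //; exact: zspan0.
move=> [//|j] ltj; apply: (IHb (fun n => c n.+1)) => //.
by move: h; rewrite c0 mulr0z add0r.
Qed.

Definition ztorsion b y : Prop := exists2 e : int, e != 0 & zspan b (y *~ e).

Lemma ztorsionD b x y : ztorsion b x -> ztorsion b y -> ztorsion b (x + y).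
Proof.
move=> [e e0 hx] [e' e'0 hy]; exists (e * e'); first by rewrite mulf_neq0.
rewrite mulrzDl; apply: zspanD; first by rewrite mulrzA; exact: zspanZ.
by rewrite mulrC mulrzA; exact: zspanZ.
Qed.

Lemma ztorsionZ b x (c : int) : ztorsion b x -> ztorsion b (x *~ c).
Proof.
by move=> [e e0 hx]; exists e => //; rewrite -mulrzA mulrC mulrzA; exact: zspanZ.
Qed.

Lemma ztorsion0 b : ztorsion b 0.
Proof. by exists 1 => //; rewrite mul0rz; exact: zspan0. Qed.

Lemma zbasis (gs : seq V) : exists b, [/\ zindep b, {subset b <= gs}
  & forall g, g \in gs -> ztorsion b g].
Proof.
elim: gs => [|g gs [b [hb sb tb]]]; first by exists [::].
have [tg|ntg] := pselect (ztorsion b g).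
  exists b; split=> // [x /sb xs|x]; rewrite inE ?xs ?orbT //.
  by move=> /orP[/eqP->|/tb].
exists (g :: b); split=> [|x|x].
- split=> // c hc; apply: contrapT => /eqP c0; apply: ntg; by exists c.
- by rewrite !inE => /orP[->//|/sb->]; rewrite orbT.
- rewrite inE => /orP[/eqP->|/tb[e e0 he]].
    by exists 1 => //; rewrite mulr1z; apply: zspan_mem; exact: mem_head.
  by exists e => //; exact: zspan_cons.
Qed.
End ZSpan.

Section Rank.
Variables (d : nat) (S : Gam d -> Prop) (b : seq (Gam d)).
Hypotheses (hb : zindep b) (bS : forall x, x \in b -> S x)
  (Sb : forall x, S x -> ztorsion b x).

Lemma int_dom : isdom int.
Proof. by move=> x y /eqP; rewrite mulf_eq0 => /orP[]/eqP->; [left|right]. Qed.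

Lemma has_rank_basis : has_rank (generated_group S) (size b).
Proof.
split.
  exists (fun j : 'I_(size b) => b`_j); split=> [j|c h j].
    exists 1%N, (fun=> b`_j), (fun=> 1); split=> [_|].
      by apply: bS; exact: mem_nth.
    by rewrite big_ord1 mulr1z.
  pose c' n := if insub n is Some j then c j else 0.
  have c'E (l : 'I_(size b)) : c' l = c l by rewrite /c' valK.
  rewrite -c'E; apply: (zindep_coords hb) => //.
  by rewrite -[RHS]h; apply: eq_bigr => l _; rewrite c'E.
move=> m x Gx hx; rewrite leqNgt; apply/negP => lt_bm.
have tx j : ztorsion b (x j).
  have [n [s [c [Ss ->]]]] := Gx j.
  apply: (big_ind (ztorsion b)) => [||l _].
  - exact: ztorsion0.
  - exact: ztorsionD.
  - by apply: ztorsionZ; exact: Sb.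
have {tx}/choice[e he] : forall j, exists e : int, e != 0 /\ exists c : nat -> int,
    x j *~ e = \sum_(l < size b) b`_l *~ c l.
  by move=> j; have [e e0 /zspan_coords[c hc]] := tx j; exists e; split=> //; exists c.
have /choice[c hc] : forall j, exists c : nat -> int,
    x j *~ e j = \sum_(l < size b) b`_l *~ c l.
  by move=> j; have [] := he j.
(* Coordinates of the multiples [x j *~ e j], padded by zero columns; a left kernel vector, rescaled
   by [e], is a relation among the [x j]. *)
pose M : 'M[int]_m := \matrix_(j, l) if (l < size b)%N then c j l else 0.
have [j|v v0 vM] := @dom_left_kernel int int_dom _ M (Ordinal lt_bm).
  by rewrite mxE /= ltnn.
move/eqP: v0; apply; apply/rowP => j; rewrite mxE.
have : v 0 j * e j = 0.
  have := hx (fun j => v 0 j * e j); apply.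
  transitivity (\sum_(l < size b) b`_l *~ (\sum_j v 0 j * c j l)).
    under eq_bigr => i0 _ do rewrite mulrC mulrzA hc mulrz_suml.
    rewrite exchange_big /=; apply: eq_bigr => l _.
    by rewrite mulrz_sumr; apply: eq_bigr => i0 _; rewrite -mulrzA mulrC.
  apply: big1 => l _.
  have := congr1 (fun w : 'rV_m => w 0 (Ordinal (ltn_trans (ltn_ord l) lt_bm))) vM.
  rewrite !mxE; under eq_bigr do rewrite mxE /= ltn_ord.
  by move=> ->; rewrite mulr0z.
move/int_dom => [//|ej]; have [] := he j; by rewrite ej eqxx.
Qed.
End Rank.

Section LexOrder.
Import Order.TTheory Num.Theory.
Variable V : zmodType.
Implicit Types (fs : seq {additive V -> int}) (x y : V).

Fixpoint lexnn fs x : bool :=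
  if fs is f :: fs' then (0 < f x) || (f x == 0) && lexnn fs' x else true.

Fixpoint vanish fs x : Prop :=
  if fs is f :: fs' then f x = 0 /\ vanish fs' x else True.

Lemma lexnn0 fs : lexnn fs 0.
Proof. by elim: fs => [//|f fs IHfs] /=; rewrite raddf0 eqxx IHfs orbT. Qed.

Lemma lexnnD fs x y : lexnn fs x -> lexnn fs y -> lexnn fs (x + y).
Proof.
elim: fs => [//|f fs IHfs] /=; rewrite raddfD.
move=> /orP[fx|/andP[/eqP-> hx]] /orP[fy|/andP[/eqP-> hy]].
- by rewrite addr_gt0.
- by rewrite addr0 fx.
- by rewrite add0r fy.
- by rewrite addr0 eqxx IHfs ?orbT.
Qed.

Lemma lexnn_total fs x : lexnn fs x || lexnn fs (- x).
Proof.
elim: fs => [//|f fs IHfs] /=; rewrite raddfN /= oppr_gt0 oppr_eq0.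
by case: ltgtP.
Qed.

Lemma lexnn_anti fs x : lexnn fs x -> lexnn fs (- x) -> vanish fs x.
Proof.
elim: fs => [//|f fs IHfs] /=; rewrite raddfN /= oppr_gt0 oppr_eq0.
by case: ltgtP => //= fx hx hy; split; [|exact: IHfs].
Qed.
End LexOrder.

Section GamOrder.
Variables (d : nat) (l : 'I_d -> int).

Definition weight (x : Gam d) : int := \sum_(j < d) l j * x.2 0 j.
Definition coord1 (x : Gam d) : int := x.1.
Definition coord2 (j : 'I_d) (x : Gam d) : int := x.2 0 j.
Definition oppweight (x : Gam d) : int := - weight x.

Lemma weightB : zmod_morphism weight.
Proof.
by move=> x y; rewrite /weight -sumrB; apply: eq_bigr => j _; rewrite !mxE mulrBr.
Qed.
HB.instance Definition _ := GRing.isZmodMorphism.Build _ _ weight weightB.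

Lemma oppweightB : zmod_morphism oppweight.
Proof. by move=> x y; rewrite /oppweight weightB opprB opprK addrC. Qed.
HB.instance Definition _ := GRing.isZmodMorphism.Build _ _ oppweight oppweightB.

Lemma coord1B : zmod_morphism coord1. Proof. by []. Qed.
HB.instance Definition _ := GRing.isZmodMorphism.Build _ _ coord1 coord1B.

Lemma coord2B j : zmod_morphism (coord2 j).
Proof. by move=> x y; rewrite /coord2 !mxE. Qed.
HB.instance Definition _ j := GRing.isZmodMorphism.Build _ _ (coord2 j) (coord2B j).

(** The coordinates after the weight only break ties, making the order antisymmetric. *)
Definition gam_keys : seq {additive Gam d -> int} :=
  (oppweight : {additive Gam d -> int}) :: (coord1 : {additive Gam d -> int})
    :: [seq (coord2 j : {additive Gam d -> int}) | j <- enum 'I_d].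

(* Weight-decreasing, so that the leading exponents of the elements of a
   filtration piece of smaller degree are larger. *)
Definition gam_le (x y : Gam d) : bool := lexnn gam_keys (y - x).

Lemma vanish_keys x : vanish gam_keys x -> x = 0.
Proof.
case: x => x1 x2 [_ [/= x10 hx]]; have -> : x1 = 0 by [].
suff -> : x2 = 0 by []; apply/rowP => j; rewrite mxE.
have : j \in enum 'I_d by rewrite mem_enum.
elim: (enum 'I_d) hx => [//|j' s IHs] /= [h0 hs]; rewrite inE.
by move=> /orP[/eqP->|/(IHs hs)].
Qed.

Lemma gam_le_order : total_group_order gam_le.
Proof.
split.
- by move=> x; rewrite /gam_le subrr lexnn0.
- move=> x y /andP[xy yx]; apply/esym/eqP; rewrite -subr_eq0; apply/eqP.
  by apply: vanish_keys; apply: lexnn_anti => //; rewrite opprB.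
- move=> y x z xy yz; rewrite /gam_le -(subrK y z) -addrA; exact: lexnnD.
- by move=> x y; rewrite /gam_le -(opprB y x) lexnn_total.
- by move=> x y z; rewrite /gam_le opprD addrACA subrr addr0.
Qed.

Lemma gam_le_weight x y : weight y < weight x -> gam_le x y.
Proof.
rewrite /gam_le /= /oppweight weightB Num.Theory.oppr_gt0 Num.Theory.subr_lt0.
by move=> ->.
Qed.
End GamOrder.

Section GroupOrder.
Variables (d : nat) (le : rel (Gam d)).
Hypothesis le_ord : total_group_order le.
Implicit Types x y z : Gam d.

Lemma gle_refl x : le x x. Proof. by case: le_ord. Qed.
Lemma gle_anti x y : le x y -> le y x -> x = y.
Proof. by case: le_ord => _ h _ _ _ xy yx; apply: h; rewrite xy. Qed.
Lemma gle_trans y x z : le x y -> le y z -> le x z.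
Proof. by case: le_ord => _ _ h _ _; exact: h. Qed.
Lemma gle_total x y : le x y \/ le y x.
Proof. by case: le_ord => _ _ _ h _; apply/orP; exact: h. Qed.
Lemma gle_add2r z x y : le x y -> le (x + z) (y + z).
Proof. by case: le_ord => _ _ _ _ h; exact: h. Qed.
Lemma gle_add x x' y y' : le x x' -> le y y' -> le (x + y) (x' + y').
Proof.
move=> hx hy; apply: (@gle_trans (x' + y)); first exact: gle_add2r.
by rewrite !(addrC x'); exact: gle_add2r.
Qed.
Lemma gle_add_eq x x' y y' : le x x' -> le y y' -> x + y = x' + y' ->
  x = x' /\ y = y'.
Proof.
move=> hx hy e; have xx : x = x'.
  apply: gle_anti => //; have := gle_add (gle_refl x') hy; rewrite -e.
  by move=> /(gle_add2r (- y)); rewrite !addrK.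
by split=> //; move: e; rewrite xx => /addrI.
Qed.

Lemma val_min_le x y : le (val_min le x y) x /\ le (val_min le x y) y.
Proof.
rewrite /val_min; case: ifP => h; first by rewrite gle_refl.
by have [|] := gle_total x y; rewrite ?h ?gle_refl // => ->.
Qed.
Lemma le_val_min x y z : le z x -> le z y -> le z (val_min le x y).
Proof. by rewrite /val_min; case: ifP. Qed.

Variable k : fieldType.
Implicit Types f g : monAlg k (Gam d).

Definition lowest f x := x \in msupp f /\ forall y, y \in msupp f -> le x y.

Definition lowexp f : Gam d :=
  if pselect (exists x, lowest f x) is left h then projT1 (cid h) else 0.

Lemma lowest_exists f : f != 0 -> exists x, lowest f x.
Proof.
move=> f0; have [x0 x0f] : exists x, x \in msupp f.
  apply: contrapT => h; move/eqP: f0; apply; apply/malgP => x; rewrite mcoeff0.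
  by apply: mcoeff_outdom; apply/negP => xf; apply: h; exists x.
suff h (s : seq (Gam d)) : s != [::] ->
    exists2 x, x \in s & forall y, y \in s -> le x y.
  have [|x xs xmin] := h (enum_fset (msupp f)); last by exists x.
  apply/eqP => s0; have : x0 \in enum_fset (msupp f) by [].
  by rewrite s0.
elim: s => [//|z s IHs] _; have [->|/IHs[x xs xmin]] := eqVneq s [::].
  by exists z; rewrite ?mem_head // => y; rewrite inE => /eqP->; exact: gle_refl.
have [xz|zx] := gle_total x z.
  exists x; first by rewrite inE xs orbT.
  by move=> y; rewrite inE => /orP[/eqP->|/xmin].
exists z; first exact: mem_head.
move=> y; rewrite inE => /orP[/eqP->|/xmin]; [exact: gle_refl|exact: gle_trans].
Qed.

Lemma lowexpP f : f != 0 -> lowest f (lowexp f).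
Proof.
move=> /lowest_exists h; rewrite /lowexp; case: pselect => // h'.
by case: (cid h').
Qed.

Lemma lowexp_eq f x : lowest f x -> lowexp f = x.
Proof.
move=> [xf xmin]; have f0 : f != 0 by apply: contraTneq xf => ->; rewrite msupp0.
by have [yf ymin] := lowexpP f0; apply: gle_anti; [exact: ymin|exact: xmin].
Qed.

Lemma mcoeff_mul f g x : mcoeff x (f * g) =
  \sum_(a <- msupp f) \sum_(b <- msupp g) (mcoeff a f * mcoeff b g) *+ (a + b == x).
Proof.
rewrite [f * g](mamulE f g) raddf_sum; apply: eq_bigr => a _.
by rewrite raddf_sum; apply: eq_bigr => b _; exact: mcoeffU.
Qed.

(** By [gle_add_eq] the exponent [x + y] comes from a single pair of exponents, so its coefficient
    is a product of two nonzero scalars. *)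
Lemma lowestM f g x y : lowest f x -> lowest g y -> lowest (f * g) (x + y).
Proof.
move=> [xf xmin] [yg ymin]; split.
  have fgx : mcoeff (x + y) (f * g) = mcoeff x f * mcoeff y g.
    rewrite mcoeff_mul (big_fsetD1 x) //= addrC big_seq big1 => [|a].
      rewrite add0r (big_fsetD1 y) //= eqxx mulr1n addrC big_seq big1 ?add0r //.
      move=> b; rewrite in_fsetD1 => /andP[by_ _]; case: eqP => // /addrI b_y.
      by rewrite b_y eqxx in by_.
    rewrite in_fsetD1 => /andP[ax /xmin xa].
    rewrite big_seq big1 // => b /ymin yb; case: eqP => // /esym e.
    by have [xa' _] := gle_add_eq xa yb e; rewrite xa' eqxx in ax.
  by rewrite -mcoeff_neq0 fgx mulf_neq0 // mcoeff_neq0.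
move=> z; rewrite -mcoeff_neq0 mcoeff_mul => nz.
have [[a [af [b [bg abz]]]]|nex] := pselect (exists a, a \in msupp f /\
    exists b, b \in msupp g /\ a + b = z).
  by rewrite -abz; apply: gle_add; [exact: xmin|exact: ymin].
move/eqP: nz; case; rewrite big_seq big1 // => a af; rewrite big_seq big1 // => b bg.
case: eqP => // abz; case: nex; exists a; split=> //; by exists b.
Qed.

Lemma monAlg_dom : isdom (monAlg k (Gam d)).
Proof.
move=> f g fg0; have [->|/lowexpP hf] := eqVneq f 0; first by left.
have [->|/lowexpP hg] := eqVneq g 0; first by right.
by have [] := lowestM hf hg; rewrite fg0 msupp0.
Qed.

Lemma lowexpM f g : f != 0 -> g != 0 -> lowexp (f * g) = lowexp f + lowexp g.
Proof. by move=> /lowexpP hf /lowexpP hg; apply: lowexp_eq; exact: lowestM. Qed.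

Lemma lowexpD f g : f != 0 -> g != 0 -> f + g != 0 ->
  le (val_min le (lowexp f) (lowexp g)) (lowexp (f + g)).
Proof.
move=> /lowexpP[_ hf] /lowexpP[_ hg] /lowexpP[+ _].
move=> /(fsubsetP (msuppD_le f g)); rewrite in_fsetU => /orP[/hf|/hg].
  by apply: gle_trans; have [] := val_min_le (lowexp f) (lowexp g).
by apply: gle_trans; have [] := val_min_le (lowexp f) (lowexp g).
Qed.

Lemma lowexp_valuation : valuation le lowexp.
Proof.
split; [exact: lowexpD|exact: lowexpM|].
move=> c f c0 /lowexpP[xf hf]; apply: lowexp_eq; split.
  by rewrite -mcoeff_neq0 mcoeffZ mulf_neq0 // mcoeff_neq0.
move=> y; rewrite -mcoeff_neq0 mcoeffZ => cy; apply: hf.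
by rewrite -mcoeff_neq0; apply: contraNneq cy => ->; rewrite mulr0.
Qed.

Lemma lowexp_mon (c : k) x : c != 0 -> lowexp (mon c x) = x.
Proof.
move=> c0; apply: lowexp_eq; rewrite /lowest /mon msuppU (negbTE c0) in_fset1 eqxx.
by split=> // y; rewrite in_fset1 => /eqP->; exact: gle_refl.
Qed.
End GroupOrder.

Section IndependentValues.
Variables (k : fieldType) (C : comAlgType k) (d : nat) (le : rel (Gam d)).
Variable v : C -> Gam d.
Hypotheses (le_ord : total_group_order le) (hv : valuation le v) (domC : isdom C).
Implicit Types f g : C.

Lemma val1 : v 1 = 0.
Proof.
have /eqP := val_M hv (oner_neq0 C) (oner_neq0 C).
by rewrite mulr1 -subr_eq0 opprD addNKr oppr_eq0 => /eqP.
Qed.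

Lemma valN f : f != 0 -> v (- f) = v f.
Proof. by move=> f0; rewrite -scaleN1r (val_Z hv) // oppr_eq0 oner_neq0. Qed.

Lemma val_neqD f g : f != 0 -> g != 0 -> v f != v g ->
  f + g != 0 /\ (v (f + g) = v f \/ v (f + g) = v g).
Proof.
move=> + + vfg; wlog hle : f g vfg / le (v f) (v g).
  move=> h f0 g0; have [hle|hle] := gle_total le_ord (v f) (v g).
    exact: h.
  have [fg0 hd] : g + f != 0 /\ (v (g + f) = v g \/ v (g + f) = v f).
    by apply: h => //; rewrite eq_sym.
  by rewrite addrC; split=> //; case: hd => ->; [right|left].
move=> f0 g0; have fg0 : f + g != 0.
  apply: contraNneq vfg => /eqP; rewrite addr_eq0 => /eqP->.
  by rewrite valN.
split=> //; left; apply: (gle_anti le_ord); last first.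
  have := val_D hv f0 g0 fg0; by rewrite /val_min hle.
have Ng0 : - g != 0 by rewrite oppr_eq0.
have := val_D hv fg0 Ng0; rewrite addrK valN // => /(_ f0).
rewrite /val_min; case: ifP => // _ gf.
by move: vfg; rewrite (gle_anti le_ord hle gf) eqxx.
Qed.

(** Along a Horner evaluation at [f], the value lies in the coset of [v f *~ j], for some natural j,
    modulo the span of the other values. Multiplying by [f] raises j to [j.+1]; as no nonzero
    multiple of [v f] is in the span, this value differs from that of the added coefficient, and the
    two terms cannot cancel. *)
Lemma val_indep (fs : seq C) : (forall f, f \in fs -> f != 0) ->
  zindep (map v fs) -> indep (GRing.in_alg C) fs /\
  forall x, gens (GRing.in_alg C) fs x -> x != 0 -> zspan (map v fs) (v x).
Proof.
elim: fs => [|f fs IHfs] /=.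
  move=> _ _; split=> // x [c ->] c0; have c1 : c != 0.
    by apply: contraNneq c0 => ->; rewrite scale0r.
  by have := val_Z hv c1 (oner_neq0 C); rewrite val1.
move=> nz [hf hz]; have f0 : f != 0 by apply: nz; exact: mem_head.
have [|ifs vfs] := IHfs _ hz; first by move=> x xs; apply: nz; rewrite inE xs orbT.
have key q : coefs_in (gens (GRing.in_alg C) fs) q -> q != 0 -> q.[f] != 0 /\
    exists j : nat, zspan (map v fs) (v q.[f] - v f *~ j%:Z).
  elim/poly_ind: q => [|q c IHq /coefs_in_cons[hq hc] qc0]; first by rewrite eqxx.
  rewrite hornerD hornerM hornerX hornerC.
  have [c0|c0] := eqVneq c 0.
    have q0 : q != 0 by apply: contraNneq qc0 => ->; rewrite c0 mul0r addr0.
    have [qf0 [j hj]] := IHq hq q0; rewrite c0 addr0.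
    split; first by apply: dommul_neq0.
    exists j.+1; rewrite (val_M hv) // -addn1 PoszD mulrzDr mulr1z opprD.
    by rewrite [- _ - v f]addrC addrA addrK.
  have vc := vfs c hc c0.
  have [->|q0] := eqVneq q 0.
    by rewrite horner0 mul0r add0r; split=> //; exists 0%N; rewrite mulr0z subr0.
  have [qf0 [j hj]] := IHq hq q0; have qff : q.[f] * f != 0 by apply: dommul_neq0.
  have vqf : v (q.[f] * f) = v q.[f] + v f by rewrite (val_M hv).
  have hj' : zspan (map v fs) (v (q.[f] * f) - v f *~ j.+1%:Z).
    rewrite vqf -addn1 PoszD mulrzDr mulr1z opprD.
    by rewrite [- _ - v f]addrC addrA addrK.
  have [|sum0 [->|->]] := @val_neqD (q.[f] * f) c qff c0.
  - apply/eqP => e; have vqfs : zspan (map v fs) (v (q.[f] * f)) by rewrite e.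
    have /hf : zspan (map v fs) (v f *~ j.+1%:Z).
      by rewrite -[_ *~ _](subKr (v (q.[f] * f))); exact: zspanB.
    by [].
  - by split=> //; exists j.+1.
  - by split=> //; exists 0%N; rewrite mulr0z subr0.
split.
  split=> // q hq qf; apply: contrapT => /eqP q0.
  by have [] := key q hq q0; rewrite qf eqxx.
move=> _ [q hq ->] qf0; have q0 : q != 0 by apply: contraNneq qf0 => ->; rewrite horner0.
by have [_ [j hj]] := key q hq q0; exists j%:Z.
Qed.
End IndependentValues.

(** * Degenerations to a semigroup algebra *)

Section DerivationRules.
Variables (B : comNzRingType) (D : B -> B).
Hypothesis hD : derivation (fun=> True) D.

Lemma derFD x y : D (x + y) = D x + D y. Proof. exact: (derD hD). Qed.
Lemma derFM x y : D (x * y) = x * D y + y * D x. Proof. exact: (derM hD). Qed.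
Lemma derFN x : D (- x) = - D x.
Proof.
have D0 : D 0 = 0.
  have /eqP := derFD 0 0; rewrite addr0 -subr_eq0 opprD addNKr oppr_eq0.
  by move=> /eqP.
by apply/eqP; rewrite -addr_eq0 addrC -derFD subrr D0.
Qed.
Lemma derFX x n : D (x ^+ n.+1) = n.+1%:R * x ^+ n * D x.
Proof.
elim: n => [|n IHn]; first by rewrite expr1 expr0 !mul1r.
by rewrite exprS derFM IHn (exprS x n) -[n.+2]addn1 natrD; ring.
Qed.
End DerivationRules.

(** Serves for the reduction modulo t, which is far from injective on [A] but becomes so on a tower
    whose generators have independent classes. *)
Lemma gens_morph_inj (k : fieldType) (B C : comNzRingType)
    (iB : {rmorphism k -> B}) (iC : {rmorphism k -> C}) (f : {rmorphism B -> C}) s :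
  (forall c, f (iB c) = iC c) -> indep iC (map f s) ->
  forall x, gens iB s x -> gens iC (map f s) (f x) /\ (f x = 0 -> x = 0).
Proof.
move=> fi; elim: s => [_ x [c ->]|z s IHs [tz ixs] x [p hp ->]] /=.
  split; first by exists c.
  by rewrite fi => /eqP; rewrite fmorph_eq0 => /eqP->; rewrite rmorph0.
have hfp : coefs_in (gens iC (map f s)) (map_poly f p).
  by move=> n; rewrite coef_map /=; have [] := IHs ixs _ (hp n).
have fpE : f p.[z] = (map_poly f p).[f z] by rewrite horner_map.
split; first by exists (map_poly f p).
rewrite fpE => /(tz _ hfp) fp0; suff -> : p = 0 by rewrite horner0.
apply/polyP => n; rewrite coef0; have [_] := IHs ixs _ (hp n); apply.
by have := congr1 (fun q : {poly C} => q`_n) fp0; rewrite coef_map coef0.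
Qed.

Lemma monX (R : comNzRingType) (M : nmodType) (c : R) (s : M) e :
  mon c s ^+ e = mon (c ^+ e) (s *+ e) :> monAlg R M.
Proof.
elim: e => [|e IHe]; first by rewrite !expr0 mulr0n.
by rewrite exprS IHe monM (exprS c e) (mulrS s e).
Qed.

Lemma mcoeff_scale (R : comNzRingType) (M : nmodType) (c : R) (f : monAlg R M) m :
  mcoeff m (c *: f) = c * mcoeff m f.
Proof. exact: mcoeffZ. Qed.

Lemma mon_scalar (R : comNzRingType) (M : nmodType) (c : R) :
  mon c 0 = c%:A :> monAlg R M.
Proof.
apply/malgP => s; rewrite mcoeffZ -mon1 /mon !mcoeffU.
by case: eqP; rewrite ?mulr1 ?mulr0.
Qed.

Lemma mon_neq0 (R : comNzRingType) (M : nmodType) (c : R) (s : M) :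
  c != 0 -> mon c s != 0 :> monAlg R M.
Proof. by move=> c0; rewrite [_ == _]monalgU_eq0. Qed.

Section Degeneration.
Variables (k : fieldType) (char0 : [pchar k] =i pred0).
Variables (A : comNzRingType) (iA : {rmorphism k -> A}) (domA : isdom A) (t : A).
Variables (V : zmodType) (pi : {rmorphism A -> monAlg k V}).
Hypothesis domC : isdom (monAlg k V).
Hypothesis pi_scalar : forall c, pi (iA c) = mon c 0.
Hypothesis pi_ker : forall a, pi a = 0 <-> exists b, a = t * b.
Variables (gs : seq A) (gs_gen : kgenerated iA gs).
Variables (S : V -> Prop) (n : nat) (g : 'I_n -> V) (h : 'I_n -> A).
Hypothesis SE : forall s, S s <-> exists c : 'I_n -> nat, s = \sum_(j < n) g j *+ c j.
Hypothesis pi_supp : forall a s, s \in msupp (pi a) -> S s.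
Hypothesis pi_h : forall j, pi (h j) = mon 1 (g j).
Variables (b : seq V) (hs : seq A).
Hypotheses (hb : zindep b) (gb : forall j, ztorsion b (g j)).
Hypothesis pi_hs : map pi hs = map (mon 1) b.

Local Notation C := (monAlg k V).

Lemma pi_t : pi t = 0.
Proof. by apply/pi_ker; exists 1; rewrite mulr1. Qed.

(** The coefficients of [y] on [b] may be negative, so [y] is written as a difference: positive
    powers go into [H'], negative ones into [H]. *)
Lemma gens_monomial y : zspan b y -> exists H P H' P',
  [/\ gens iA hs H /\ gens iA hs H', pi H = mon 1 P, pi H' = mon 1 P' & y = P' - P].
Proof.
elim: b hs pi_hs y => [|z b' IHb] [|f hs'] //=.
  move=> _ y ->; exists 1, 0, 1, 0; rewrite subrr rmorph1; split=> //.
  by split; exists 1; rewrite rmorph1.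
move=> [fE hE] y [c /(IHb _ hE)[H [P [H' [P' [[gH gH'] HE HE' yE]]]]]].
have hs0 := ksub_gens iA hs'; have hs1 := ksub_gens iA (f :: hs').
have gf : gens iA (f :: hs') f by exact: (adj_gen hs0).
have sub := @sub_adj _ _ _ _ hs0 f.
have {}yE : y = P' - P + z *~ c by rewrite -yE subrK.
case: c yE => e yE.
  exists H, P, (H' * f ^+ e), (P' + z *+ e).
  rewrite rmorphM rmorphXn fE HE' monX monM expr1n mulr1 yE addrAC; split=> //.
  by split; [exact: sub|apply: (ksubM hs1); [exact: sub|exact: (ksubX hs1)]].
exists (H * f ^+ e.+1), (P + z *+ e.+1), H', P'.
rewrite rmorphM rmorphXn fE HE monX monM expr1n mulr1 yE NegzE mulrNz opprD addrA.
split=> //; split; last exact: sub.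
by apply: (ksubM hs1); [exact: sub|exact: (ksubX hs1)].
Qed.

Lemma monomial_lift (G : A -> Prop) : ksub iA G -> (forall j, G (h j)) ->
  forall (c : k) s, S s -> exists2 a, G a & pi a = mon c s.
Proof.
move=> hG Gh c s /SE[e ->].
exists (iA c * \prod_(j < n) h j ^+ e j).
  apply: (ksubM hG); first exact: (ksubC hG).
  by apply: (ksub_prod hG) => j _; apply: (ksubX hG).
rewrite rmorphM pi_scalar rmorph_prod.
have -> : \prod_(j < n) pi (h j ^+ e j) = mon 1 (\sum_(j < n) g j *+ e j) :> C.
  apply: (big_ind2 (fun (x : C) y => x = mon 1 y)) => [//|x y x' y' -> ->|j _].
    by rewrite monM mulr1.
  by rewrite rmorphXn pi_h monX expr1n.
by rewrite monM mulr1 add0r.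
Qed.

(** One correction by monomials in [h] is enough: the remainder is in (t), all of which [G]
    contains, so no t-adic convergence is involved. *)
Lemma monomial_span (G : A -> Prop) : ksub iA G -> (forall j, G (h j)) ->
  (forall a, G (t * a)) -> forall a, G a.
Proof.
move=> hG Gh Gt a.
suff [a' Ga' pa'] : exists2 a', G a' & pi a' = pi a.
  have [c cE] : exists c, a - a' = t * c by apply/pi_ker; rewrite rmorphB pa' subrr.
  by rewrite -(subrK a' a) cE; exact: (ksubD hG).
have paE : pi a = \sum_(s <- msupp (pi a)) mon (mcoeff s (pi a)) s := monalgE _.
suff hsum (r : seq V) : (forall s, s \in r -> S s) -> exists2 a', G a' &
    pi a' = \sum_(s <- r) mon (mcoeff s (pi a)) s.
  by rewrite paE; apply: hsum => s; exact: pi_supp.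
elim: r => [_|s r IHr hr]; first by exists 0; rewrite ?rmorph0 ?big_nil //; exact: (ksub0 hG).
have [|a1 Ga1 a1E] := IHr; first by move=> s' s'r; apply: hr; rewrite inE s'r orbT.
have [a2 Ga2 a2E] := monomial_lift hG Gh (mcoeff s (pi a)) (hr _ (mem_head _ _)).
exists (a2 + a1); first exact: (ksubD hG).
by rewrite big_cons rmorphD a1E a2E.
Qed.

(* Modulo t every generator satisfies a separable equation over k[hs], so the
   values of D on the generators solve a linear system whose determinant is
   nonzero modulo t. *)
Lemma derivation_zero (D : A -> A) : derivation (fun=> True) D ->
  (forall c, D (iA c) = 0) -> D t = 0 -> (forall x, x \in hs -> D x = 0) ->
  forall x, D x = 0.
Proof.
move=> hD Dc Dt Dhs.
have Dgens x : gens iA hs x -> D x = 0.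
  move: x; apply: gens_min => //; split=> [//|x y Dx Dy|x y Dx Dy].
    by rewrite (derFD hD) Dx Dy addr0.
  by rewrite (derFM hD) Dx Dy !mulr0 addr0.
pose M m := exists c : nat -> A, m = \sum_(j < size gs) c j * D gs`_j.
have M0 : M 0 by exists (fun=> 0); rewrite big1 // => j _; rewrite mul0r.
have MD x y : M x -> M y -> M (x + y).
  move=> [c ->] [c' ->]; exists (fun j => c j + c' j); rewrite -big_split /=.
  by apply: eq_bigr => j _; rewrite mulrDl.
have MZ x y : M y -> M (x * y).
  move=> [c ->]; exists (fun j => x * c j); rewrite mulr_sumr.
  by apply: eq_bigr => j _; rewrite mulrA.
have MDx : forall x, M (D x).
  apply: gs_gen; first split=> [c|x y Mx My|x y Mx My].
  - by rewrite Dc.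
  - by rewrite (derFD hD); exact: MD.
  - by rewrite (derFM hD); apply: MD; exact: MZ.
  move=> x /(nthP 0)[j ltj <-]; exists (fun l => (l == j)%:R).
  rewrite (bigD1 (Ordinal ltj)) //= eqxx mul1r big1 ?addr0 // => l lj.
  by rewrite (_ : (l == j :> nat) = false) ?mul0r //; apply/negbTE.
(* [M] is the [A]-module spanned by the values of [D]. [G] collects the x with [D x] in t M up to a
   factor outside (t); such factors multiply, as their classes live in a domain. *)
pose G x := exists2 w, pi w != 0 & exists2 m, M m & w * D x = t * m.
have hG : ksub iA G.
  split=> [c|x y [w w0 [m Mm wE]] [w' w'0 [m' Mm' w'E]]
      |x y [w w0 [m Mm wE]] [w' w'0 [m' Mm' w'E]]].
  - exists 1; first by rewrite rmorph1 oner_neq0.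
    by exists 0 => //; rewrite Dc !mulr0.
  - exists (w * w'); first by rewrite rmorphM; exact: dommul_neq0.
    exists (w' * m + w * m'); first by apply: MD; exact: MZ.
    have -> : w * w' * D (x + y) = w' * (w * D x) + w * (w' * D y).
      by rewrite (derFD hD); ring.
    by rewrite wE w'E; ring.
  - exists (w * w'); first by rewrite rmorphM; exact: dommul_neq0.
    exists (y * w' * m + x * w * m'); first by apply: MD; exact: MZ.
    have -> : w * w' * D (x * y) = y * w' * (w * D x) + x * w * (w' * D y).
      by rewrite (derFM hD); ring.
    by rewrite wE w'E; ring.
have Gh j : G (h j).
  have [e e0 he] := gb j.
  have {e e0 he} [e /gens_monomial[H [P [H' [P' [[gH gH'] HE HE' gE]]]]]] :
      exists e : nat, zspan b (g j *~ e.+1).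
    case: e e0 he => [[//|e]|e] _ he; first by exists e.
    by exists e; rewrite -[_ *~ _]opprK -mulrNz -NegzE -sub0r; apply: zspanB => //; exact: zspan0.
  (* A positive multiple of [g j] lies in the span of [b], so [h j ^+ e.+1 * H] and [H'] agree
     modulo t. As [D] kills [H], [H'] and t, differentiating gives w D(h j) = t D(y) with w = (e +
     1) (h j)^e H, nonzero modulo t in characteristic 0. *)
  have [y yE] : exists y, h j ^+ e.+1 * H - H' = t * y.
    apply/pi_ker; rewrite rmorphB rmorphM rmorphXn HE HE' pi_h monX expr1n monM.
    rewrite mulr1 (_ : g j *+ e.+1 + P = P') ?subrr //.
    by rewrite -[g j *+ _]/(g j *~ e.+1%:Z) gE subrK.
  exists (H * (e.+1%:R * h j ^+ e)).
    rewrite !rmorphM rmorphXn rmorph_nat pi_h monX HE.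
    have iC := GRing.in_alg C.
    apply: dommul_neq0 => //; first exact: mon_neq0 (oner_neq0 _).
    apply: dommul_neq0 => //; last by apply: mon_neq0; rewrite expr1n oner_neq0.
    exact: (natB_neq0 (GRing.in_alg C) char0).
  exists (D y); first exact: MDx.
  have : D (h j ^+ e.+1 * H - H') = D (t * y) by rewrite yE.
  rewrite (derFD hD) (derFN hD) (Dgens H') // oppr0 addr0 !(derFM hD) Dt (Dgens H) //.
  by rewrite !mulr0 addr0 add0r (derFX hD) => <-; ring.
have Gt a : G (t * a).
  exists 1; first by rewrite rmorph1 oner_neq0.
  by exists (D a); [exact: MDx|rewrite mul1r (derFM hD) Dt mulr0 addr0].
have allG := monomial_span hG Gh Gt.
have /choice[w hw] : forall j : 'I_(size gs), exists w, pi w != 0 /\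
    exists c : nat -> A, w * D gs`_j = t * \sum_(l < size gs) c l * D gs`_l.
  by move=> j; have [w w0 [_ [c ->] wE]] := allG gs`_j; exists w; split=> //; exists c.
have /choice[c hc] : forall j : 'I_(size gs), exists c : nat -> A,
    w j * D gs`_j = t * \sum_(l < size gs) c l * D gs`_l.
  by move=> j; have [] := hw j.
pose W : 'M[A]_(size gs) :=
  diag_mx (\row_j w j) - t *: \matrix_(j, l) c j l.
pose v : 'cV[A]_(size gs) := \col_j D gs`_j.
have Wv : W *m v = 0.
  apply/colP => j; rewrite mulmxBl mul_diag_mx -scalemxAl !mxE hc.
  apply/eqP; rewrite subr_eq0; apply/eqP; congr (_ * _).
  by apply: eq_bigr => l _; rewrite !mxE.
have piW : map_mx pi W = diag_mx (\row_j pi (w j)).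
  apply/matrixP => j l; rewrite !mxE rmorphB rmorphM pi_t mul0r subr0.
  by rewrite rmorphMn.
have detW : \det W != 0.
  apply/eqP => dW; have := det_map_mx pi W.
  rewrite dW rmorph0 piW det_diag => /eqP; apply/negP.
  elim/big_ind: _ => [|x y|j _]; first exact: oner_neq0.
    exact: dommul_neq0.
  by rewrite mxE; have [] := hw j.
have Dgs j : (j < size gs)%N -> D gs`_j = 0.
  move=> ltj; have : (\det W *: v) (Ordinal ltj) 0 = 0.
    by rewrite -mul_scalar_mx -mul_adj_mx -mulmxA Wv mulmx0 mxE.
  by rewrite !mxE /= => /domA[/eqP|//]; rewrite (negbTE detW).
move=> x; have [c' ->] := MDx x; rewrite big1 // => j _.
by rewrite Dgs // mulr0.
Qed.

(** A transcendental [a] would carry, by [der_separating], a derivation killing k, t and [hs] but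
    not [a]. *)
Lemma algebraic_over_basis a : ~ trans (gens iA (t :: hs)) a.
Proof.
move=> /(der_separating char0 domA gs_gen)[D [hD D0]]; apply/negP; rewrite negbK.
apply/eqP; apply: derivation_zero => //.
- by move=> c; apply: D0; exact: (ksubC (ksub_gens iA (t :: hs))).
- by apply: D0; apply: gens_mem; exact: mem_head.
- by move=> x xs; apply: D0; apply: gens_mem; rewrite inE xs orbT.
Qed.

Lemma indep_size_le xs : indep iA xs -> (size xs <= (size b).+1)%N.
Proof.
have -> : (size b).+1 = size (t :: hs).
  by rewrite /= -(size_map pi hs) pi_hs size_map.
apply: rank_bound gs_gen _ => // D hD Dc Dths; apply: derivation_zero => //.
  by apply: Dths; exact: mem_head.
by move=> x xin; apply: Dths; rewrite inE xin orbT.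
Qed.

Hypothesis gens_pi_inj : forall x, gens iA hs x -> pi x = 0 -> x = 0.
Hypothesis t_neq0 : t != 0.

(* A t-divisible a is algebraic over gens (t :: hs); the constant term of a
   relation of least degree would be t-divisible, hence zero because hs stays
   independent modulo t. *)
Lemma not_t_divisible a : a != 0 -> exists m, forall c, a <> t ^+ m * c.
Proof.
move=> a0; apply: contrapT => ndiv.
have {ndiv} adiv m : exists c, a = t ^+ m * c.
  by apply: contrapT => h'; apply: ndiv; exists m => c ac; apply: h'; exists c.
pose J x := forall m, exists c, x = t ^+ m * c.
have cancel_t x y : t * x = t * y -> x = y.
  move=> /eqP; rewrite -subr_eq0 -mulrBr => /eqP/domA[/eqP|/eqP].
    by rewrite (negbTE t_neq0).
  by rewrite subr_eq0 => /eqP.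
(* No nonzero element of k[t, hs] is divisible by all powers of t: the constant term [e] vanishes
   modulo t, hence is 0, and cancelling one t leaves an element of the same kind. *)
have keyt (r : {poly A}) : coefs_in (gens iA hs) r -> J r.[t] -> r = 0.
  elim/poly_ind: r => [//|r e IHr /coefs_in_cons[hr he]].
  rewrite hornerD hornerM hornerX hornerC => Jr.
  have e0 : e = 0.
    apply: gens_pi_inj => //; have [c cE] := Jr 1%N.
    by apply/pi_ker; exists (c - r.[t]); rewrite mulrBr -[t]expr1 -cE expr1; ring.
  rewrite (IHr hr) ?e0 ?mul0r ?add0r // => m.
  have [c cE] := Jr m.+1; exists c; apply: cancel_t.
  by rewrite mulrA -exprS -cE e0 addr0 mulrC.
have [p [hp pa p0]] := not_trans (algebraic_over_basis (a := a)).
suff q0 (q : {poly A}) : coefs_in (gens iA (t :: hs)) q -> q.[a] = 0 -> q = 0.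
  by move: p0; rewrite (q0 p) ?eqxx.
elim/poly_ind: q => [//|q c IHq /coefs_in_cons[hq [r hr cE]]].
rewrite hornerD hornerM hornerX hornerC => qa.
have c0 : c = 0.
  rewrite cE (keyt r) ?horner0 // -cE => m; have [a' a'E] := adiv m.
  exists (- q.[a] * a'); rewrite mulrCA -a'E; apply/eqP.
  by rewrite -subr_eq0 mulNr opprK addrC qa.
move: qa; rewrite c0 addr0 => /domA[/(IHq hq)->|/eqP]; first by rewrite mul0r addr0.
by rewrite (negbTE a0).
Qed.

(** Pulling the chain back to [A] and putting the zero ideal below it gains one step, because [rho]
    has a nonzero kernel; this offsets the extra one that t contributes in [indep_size_le]. *)
Lemma quotient_chain_le (R : comNzRingType) (rho : {rmorphism A -> R}) m p :
  (forall r, exists a, rho a = r) -> (exists2 a, a != 0 & rho a = 0) ->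
  @prime_chain R m p -> (m <= size b)%N.
Proof.
move=> rho_surj [a0 a0_neq0 ra0] [hp sp].
pose q j : {pred A} := if j is j'.+1 then fun a => rho a \in p j' else fun a => a == 0.
have qS j a : (a \in q j.+1) = (rho a \in p j) by [].
have q0 a : (a \in q 0%N) = (a == 0) by [].
suff /(prime_chain_indep iA)[xs sxs /indep_size_le] : prime_chain m.+1 q.
  by rewrite sxs ltnS.
split=> [[_|j ltj]|[_|j ltj]].
- split; first split; rewrite ?q0 ?eqxx ?oner_neq0 //.
    by move=> a u v; rewrite !q0 => /eqP-> /eqP->; rewrite mulr0 addr0.
  by move=> u v; rewrite !q0 => /eqP/domA[->|->]; rewrite eqxx ?orbT.
- have hpj := hp j ltj; split; first split; rewrite ?qS ?rmorph0 ?rmorph1.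
  + exact: (prime0 hpj).
  + exact: (prime1 hpj).
  + move=> a u v; rewrite !qS rmorphD rmorphM => hu hv.
    by apply: (primeD hpj) => //; exact: (primeMl hpj).
  + by move=> u v; rewrite !qS rmorphM => /(primeM hpj)[->|->]; rewrite ?orbT.
- have hpj := hp 0%N (leq0n _); split=> [a|].
    by rewrite q0 qS => /eqP->; rewrite rmorph0; exact: (prime0 hpj).
  by exists a0; rewrite ?q0 // qS ra0; exact: (prime0 hpj).
- have [sub [x xp xnp]] := sp j ltj; split=> [a|]; first by rewrite !qS; exact: sub.
  by have [a ra] := rho_surj x; exists a; rewrite qS ra.
Qed.
End Degeneration.

(** * Weights of the action and homogeneous lifts *)

Section LaurentEvaluation.
Variables (k : fieldType) (R : comAlgType k) (c : k) (c0 : c != 0).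
Implicit Types f g : monAlg R int.

(* The proof of c != 0 is an argument so that the ring morphism structure can be
   inferred. *)
Definition laurent_eval of c != 0 := fun f : monAlg R int =>
  \sum_(m <- msupp f) mcoeff m f * (c ^ m)%:A.

Local Notation ev := (laurent_eval c0).

Lemma laurent_evalw (D : {fset int}) f : (msupp f `<=` D)%fset ->
  ev f = \sum_(m <- D) mcoeff m f * (c ^ m)%:A.
Proof.
move=> sD; rewrite /laurent_eval (big_fset_incl _ sD) //= => m _ /mcoeff_outdom->.
by rewrite mul0r.
Qed.

Lemma laurent_evalB : zmod_morphism ev.
Proof.
move=> f g; have sf := fsubsetUl (msupp f) (msupp g).
have sg := fsubsetUr (msupp f) (msupp g).
rewrite (laurent_evalw sf) (laurent_evalw sg) (laurent_evalw (msuppB_le _ _)).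
by rewrite -sumrB; apply: eq_bigr => m _; rewrite mcoeffB mulrBl.
Qed.
HB.instance Definition _ :=
  GRing.isZmodMorphism.Build (monAlg R int) R ev laurent_evalB.

Lemma laurent_eval_mon r m : ev (mon r m) = r * (c ^ m)%:A.
Proof.
rewrite (@laurent_evalw [fset m]%fset) ?msuppU_le // big_seq_fset1.
by rewrite /mon mcoeffUU.
Qed.

Lemma laurent_evalM : monoid_morphism ev.
Proof.
split; first by rewrite -mon1 laurent_eval_mon expr0z scale1r mulr1.
move=> f g; rewrite [f * g](mamulE f g) raddf_sum /= {2 3}/laurent_eval mulr_suml.
apply: eq_bigr => m _; rewrite raddf_sum mulr_sumr; apply: eq_bigr => n _.
rewrite [LHS]laurent_eval_mon expfzDr // -mulrACA; congr (_ * _).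
by rewrite -scalerAl mul1r scalerA.
Qed.
HB.instance Definition _ :=
  GRing.isMonoidMorphism.Build (monAlg R int) R ev laurent_evalM.
End LaurentEvaluation.

Lemma int_comparable (j l : int) : exists n : nat, l = j + n%:Z \/ j = l + n%:Z.
Proof.
case E: (l - j) => [n|n]; [exists n; left|exists n.+1; right].
  by rewrite -E addrC subrK.
by rewrite -[n.+1%:Z]opprK -NegzE -E opprB addrC subrK.
Qed.

Section Weights.
Variables (k : fieldType) (char0 : [pchar k] =i pred0).
Variables (A : comNzRingType) (iA : {rmorphism k -> A}) (domA : isdom A).
Variables (t : A) (t_neq0 : t != 0) (act : k -> A -> A).
Hypothesis act1 : forall a, act 1 a = a.
Hypothesis actM : forall z w, z != 0 -> w != 0 ->
  forall a, act (z * w) a = act z (act w a).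
Hypothesis act_add : forall z, z != 0 -> forall a b, act z (a + b) = act z a + act z b.
Hypothesis act_mul : forall z, z != 0 -> forall a b, act z (a * b) = act z a * act z b.
Hypothesis act_scalar : forall z, z != 0 -> forall c, act z (iA c) = iA c.
Hypothesis act_t : forall z, z != 0 -> act z t = iA z * t.
Hypothesis act_regular : forall a, exists (N : nat) (e : 'I_N -> int) (b : 'I_N -> A),
  forall z, z != 0 -> act z a = \sum_(i < N) iA (z ^ e i) * b i.
Implicit Types (a b : A) (j l : int).

Definition homog j a := forall z, z != 0 -> act z a = iA (z ^ j) * a.

Lemma act0 z : z != 0 -> act z 0 = 0.
Proof. by move=> z0; rewrite -(rmorph0 iA) act_scalar. Qed.

Lemma act_sum z (I : Type) (r : seq I) (F : I -> A) : z != 0 ->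
  act z (\sum_(i <- r) F i) = \sum_(i <- r) act z (F i).
Proof.
by move=> z0; apply: (big_morph (act z)) => [a b|]; [exact: act_add|exact: act0].
Qed.

Lemma homog0 j : homog j 0.
Proof. by move=> z z0; rewrite act0 // mulr0. Qed.

Lemma homogD j a b : homog j a -> homog j b -> homog j (a + b).
Proof. by move=> ha hb z z0; rewrite act_add // ha // hb // mulrDr. Qed.

Lemma homogM j l a b : homog j a -> homog l b -> homog (j + l) (a * b).
Proof.
by move=> ha hb z z0; rewrite act_mul // ha // hb // expfzDr // rmorphM mulrACA.
Qed.

Lemma homog_scalar c : homog 0 (iA c).
Proof. by move=> z z0; rewrite act_scalar // expr0z rmorph1 mul1r. Qed.

Lemma homog_tX n : homog n%:Z (t ^+ n).
Proof.
elim: n => [|n IHn]; first by rewrite expr0 -(rmorph1 iA); exact: homog_scalar.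
rewrite exprS -addn1 addnC PoszD; exact: homogM.
Qed.

Lemma homogB j a b : homog j a -> homog j b -> homog j (a - b).
Proof.
move=> ha hb; apply: homogD => //; rewrite -mulN1r -(rmorphN1 iA) -(add0r j).
by apply: homogM => //; exact: homog_scalar.
Qed.

Lemma homog_tdiv n j a : homog j (t ^+ n * a) -> homog (j - n%:Z) a.
Proof.
move=> ha z z0; set u := iA (z ^ n%:Z).
have zj : iA (z ^ j) = iA (z ^ (j - n%:Z)) * u.
  by rewrite -rmorphM -expfzDr // subrK.
have /eqP : u * (t ^+ n * act z a) = u * (t ^+ n * (iA (z ^ (j - n%:Z)) * a)).
  rewrite mulrA -(homog_tX n z0) -act_mul // ha // zj; ring.
rewrite -subr_eq0 -!mulrBr => /eqP/domA[/eqP|/domA[/eqP|/eqP]].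
- by rewrite fmorph_eq0 expfz_eq0 (negbTE z0) andbF.
- by rewrite (negbTE (domexp_neq0 domA n t_neq0)).
- by rewrite subr_eq0 => /eqP.
Qed.

(** Grouping the terms of the orbit map by exponent gives the candidates [c j]. Expanding
    [act (z * w) a] in two ways and comparing powers of [w] by [power_indep] shows that they are
    weight vectors; the point 1 gives the sum. *)
Lemma homog_decomposition a : exists (r : seq int) (c : int -> A),
  [/\ uniq r, forall j, homog j (c j) & a = \sum_(j <- r) c j].
Proof.
have [N [e [b hb]]] := act_regular a.
pose r := undup [seq e i | i <- enum 'I_N].
pose c j := \sum_(i < N | e i == j) b i.
have er i : e i \in r by rewrite mem_undup map_f // mem_enum.
have ur : uniq r by exact: undup_uniq.
have hc z : z != 0 -> act z a = \sum_(j <- r) iA (z ^ j) * c j.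
  move=> z0; rewrite hb //; under [RHS]eq_bigr do rewrite mulr_sumr big_mkcond.
  rewrite exchange_big /=; apply: eq_bigr => i _.
  rewrite (bigD1_seq (e i)) //= eqxx big1 ?addr0 // => j /negbTE.
  by rewrite eq_sym => ->.
have cr j : j \notin r -> c j = 0.
  by move=> jr; rewrite /c big_pred0 // => i; apply: contraNF jr => /eqP<-.
exists r, c; split=> // [j z z0|]; last first.
  rewrite -{1}(act1 a) hc ?oner_neq0 //; apply: eq_bigr => j _.
  by rewrite exp1rz rmorph1 mul1r.
have [jr|/cr->] := boolP (j \in r); last by rewrite act0 // mulr0.
apply/eqP; rewrite -subr_eq0; apply/eqP.
apply: (power_indep char0 (b := fun j => act z (c j) - iA (z ^ j) * c j) ur) jr => w w0.
have zwE : act (z * w) a = \sum_(j <- r) iA (w ^ j) * act z (c j).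
  rewrite actM // (hc w w0) act_sum //; apply: eq_bigr => l _.
  by rewrite act_mul // act_scalar.
have : act (z * w) a - act (z * w) a = 0 by rewrite subrr.
rewrite {1}zwE hc ?mulf_neq0 // -sumrB => h; rewrite -[RHS]h; apply: eq_bigr => l _.
by rewrite expfzMl rmorphM; ring.
Qed.

Variables (R : comNzRingType) (rho : {rmorphism A -> R}).
Hypothesis rho_t : rho t = 1.
Hypothesis rho_inj : forall j a, homog j a -> rho a = 0 -> a = 0.
Hypothesis rho_surj : forall r, exists a, rho a = r.
Hypothesis not_tdiv : forall a, a != 0 -> exists m, forall c, a <> t ^+ m * c.

Lemma homog_same j n a b : homog j a -> homog (j + n%:Z) b -> rho a = rho b ->
  b = t ^+ n * a.
Proof.
move=> ha hb rab; apply/eqP; rewrite -subr_eq0; apply/eqP.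
apply: (rho_inj (j := j + n%:Z)).
  by apply: homogB => //; rewrite addrC; apply: homogM => //; exact: homog_tX.
by rewrite rmorphB rmorphM rmorphXn rho_t expr1n mul1r rab subrr.
Qed.

(** Since [rho t = 1], a power of t equalizes the weights without changing the image in [R]. *)
Lemma homog_add_rho j l a b : homog j a -> homog l b ->
  exists m c, homog m c /\ rho c = rho a + rho b.
Proof.
wlog [n ->] : j l a b / exists n : nat, l = j + n%:Z.
  move=> h ha hb; have [n [lj|jl]] := int_comparable j l.
  - by apply: (h j l) => //; exists n.
  - have [|m [c [hc rc]]] := h l j b a _ hb ha; first by exists n.
    by exists m, c; rewrite addrC.
move=> ha hb; exists (j + n%:Z), (t ^+ n * a + b); split.
  by apply: homogD => //; rewrite addrC; apply: homogM => //; exact: homog_tX.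
by rewrite rmorphD rmorphM rmorphXn rho_t expr1n mul1r.
Qed.

Lemma homog_rho_surj r : exists j a, homog j a /\ rho a = r.
Proof.
have [a <-] := rho_surj r; have [s [c [_ hc ->]]] := homog_decomposition a.
elim: s => [|j s [l [b [hb rb]]]].
  by exists 0, 0; rewrite big_nil; split=> //; exact: homog0.
have [m [e [he re]]] := homog_add_rho (hc j) hb.
by exists m, e; rewrite big_cons rmorphD -rb.
Qed.

(* Every nonzero f has exactly one such lift a; its class modulo t is the initial
   form of f for the filtration of R by the degrees of its homogeneous lifts. *)
Definition t_lift (f : R) (j : int) (a : A) : Prop :=
  [/\ homog j a, rho a = f & forall c, a <> t * c].

Lemma homog_t_part j a : homog j a -> a != 0 -> exists n b,
  [/\ a = t ^+ n * b, homog (j - n%:Z) b & forall c, b <> t * c].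
Proof.
move=> ha /not_tdiv[m hm].
have exP : exists m, `[< forall c, a <> t ^+ m * c >] by exists m; apply/asboolP.
have [[/asboolP/(_ a)|n /asboolP hn nmin]] := ex_minnP exP.
  by rewrite expr0 mul1r.
have [b ab] : exists b, a = t ^+ n * b.
  apply: contrapT => h; have : (n < n)%N; last by rewrite ltnn.
  by apply: nmin; apply/asboolP => c ac; apply: h; exists c.
exists n, b; split=> //; first by apply: homog_tdiv; rewrite -ab.
by move=> c bc; apply: (hn c); rewrite exprSr -mulrA -bc.
Qed.

Lemma t_lift_exists f : f != 0 -> exists j a, t_lift f j a.
Proof.
move=> f0; have [j [a [ha ra]]] := homog_rho_surj f.
have a0 : a != 0 by apply: contraNneq f0 => a0; rewrite -ra a0 rmorph0.
have [n [b [ab hb tb]]] := homog_t_part ha a0.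
exists (j - n%:Z), b; split=> //.
by rewrite -ra ab rmorphM rmorphXn rho_t expr1n mul1r.
Qed.

Lemma t_lift_unique f j a l b : t_lift f j a -> t_lift f l b -> a = b.
Proof.
wlog [n ->] : j l a b / exists n : nat, l = j + n%:Z.
  move=> h ha hb; have [n [lj|jl]] := int_comparable j l.
  - by apply: (h j l) => //; exists n.
  - by apply/esym; apply: (h l j b a) => //; exists n.
move=> [ha ra ta] [hb rb tb].
have := homog_same ha hb (etrans ra (esym rb)).
case: n hb => [|n] hb; first by rewrite expr0 mul1r.
by rewrite exprS -mulrA => /tb.
Qed.
End Weights.

(** * The valuation read off from initial forms *)

Section InitialValuation.
Variables (k : fieldType) (char0 : [pchar k] =i pred0).
Variables (A : comNzRingType) (iA : {rmorphism k -> A}) (domA : isdom A).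
Variables (t : A) (t_neq0 : t != 0) (act : k -> A -> A).
Hypothesis act1 : forall a, act 1 a = a.
Hypothesis actM : forall z w, z != 0 -> w != 0 ->
  forall a, act (z * w) a = act z (act w a).
Hypothesis act_add : forall z, z != 0 -> forall a b, act z (a + b) = act z a + act z b.
Hypothesis act_mul : forall z, z != 0 -> forall a b, act z (a * b) = act z a * act z b.
Hypothesis act_scalar : forall z, z != 0 -> forall c, act z (iA c) = iA c.
Hypothesis act_t : forall z, z != 0 -> act z t = iA z * t.
Hypothesis act_regular : forall a, exists (N : nat) (e : 'I_N -> int) (b : 'I_N -> A),
  forall z, z != 0 -> act z a = \sum_(i < N) iA (z ^ e i) * b i.
Variables (R : comAlgType k) (rho : {rmorphism A -> R}).
Hypothesis rho_scalar : forall c, rho (iA c) = c%:A.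
Hypothesis rho_t : rho t = 1.
Hypothesis rho_inj : forall j a, homog iA act j a -> rho a = 0 -> a = 0.
Hypothesis rho_surj : forall r, exists a, rho a = r.
Hypothesis not_tdiv : forall a, a != 0 -> exists m, forall c, a <> t ^+ m * c.
Variables (d : nat) (le : rel (Gam d)) (wt : Gam d -> int).
Hypothesis le_ord : total_group_order le.
Hypothesis le_wt : forall x y, Num.lt (wt y) (wt x) -> le x y.
Variable pi : {rmorphism A -> monAlg k (Gam d)}.
Hypothesis pi_scalar : forall c, pi (iA c) = mon c 0.
Hypothesis pi_ker : forall a, pi a = 0 <-> exists b, a = t * b.
Hypothesis pi_wt : forall j a s, homog iA act j a -> s \in msupp (pi a) -> wt s = j.

Local Notation lift := (t_lift iA t act rho).

Lemma lift_pi_neq0 f j a : lift f j a -> pi a != 0.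
Proof. by move=> [_ _ ta]; apply/eqP => /pi_ker[c /ta]. Qed.

Lemma lift_value_exists : exists v : R -> Gam d,
  forall f j a, f != 0 -> lift f j a -> v f = lowexp le (pi a).
Proof.
have /choice[v hv] : forall f, exists x, forall j a, f != 0 -> lift f j a ->
    x = lowexp le (pi a).
  move=> f; have [->|f0] := eqVneq f 0; first by exists 0 => j a /eqP.
  have [j [a ha]] := t_lift_exists char0 domA t_neq0 act1 actM act_add act_mul
    act_scalar act_t act_regular rho_t rho_surj not_tdiv f0.
  exists (lowexp le (pi a)) => l b _ hb; congr (lowexp le (pi _)).
  exact: (t_lift_unique act_add act_mul act_scalar act_t rho_t rho_inj ha hb).
by exists v => f j a f0 ha; exact: (hv f j a f0 ha).
Qed.

Variable v : R -> Gam d.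
Hypothesis vE : forall f j a, f != 0 -> lift f j a -> v f = lowexp le (pi a).

Let lifts f : f != 0 -> exists j a, lift f j a.
Proof.
exact: (t_lift_exists char0 domA t_neq0 act1 actM act_add act_mul
  act_scalar act_t act_regular rho_t rho_surj not_tdiv).
Qed.

(** The ideal (t) is prime, being the kernel of [pi], a morphism to a domain. *)
Lemma lift_M f g j l a b : lift f j a -> lift g l b -> lift (f * g) (j + l) (a * b).
Proof.
move=> ha hb; have pa := lift_pi_neq0 ha; have pb := lift_pi_neq0 hb.
case: ha hb => [ha ra ta] [hb rb tb]; split.
- exact: (homogM act_mul).
- by rewrite rmorphM ra rb.
- move=> c abc; have /pi_ker/eqP : exists c, a * b = t * c by exists c.
  by apply/negP; rewrite rmorphM; apply: dommul_neq0 => //; exact: (monAlg_dom le_ord).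
Qed.

Lemma value_D f g : f != 0 -> g != 0 -> f + g != 0 ->
  le (val_min le (v f) (v g)) (v (f + g)).
Proof.
move=> f0 g0 fg0; have [j [a ha]] := lifts f0; have [l [b hb]] := lifts g0.
have [n ln] := int_comparable j l.
wlog ln' : f g j l a b f0 g0 fg0 ha hb {ln} / l = j + n%:Z.
  move=> h; case: ln => [lj|jl]; first exact: (h f g j l a b f0 g0 fg0 ha hb lj).
  have gf0 : g + f != 0 by rewrite addrC.
  have := h g f l j b a g0 f0 gf0 hb ha jl; rewrite addrC.
  apply: (gle_trans le_ord); have [hf hg] := val_min_le le_ord (v f) (v g).
  exact: le_val_min.
have [hf hg] := val_min_le le_ord (v f) (v g).
have pa := lift_pi_neq0 ha; have pb := lift_pi_neq0 hb.
have [ha1 ra ta] := ha; have [hb1 rb tb] := hb.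
have [m [e he]] := lifts fg0; have [he1 re te] := he.
pose s := t ^+ n * a + b.
have hs : homog iA act l s.
  apply: (homogD act_add) => //; rewrite ln' addrC.
  by apply: (homogM act_mul) => //; exact: (homog_tX act_mul act_scalar act_t).
have rs : rho s = f + g by rewrite rmorphD rmorphM rmorphXn rho_t expr1n mul1r ra rb.
have s0 : s != 0 by apply: contraNneq fg0 => s0; rewrite -rs s0 rmorph0.
have [q [c [sq hc tc]]] := homog_t_part domA t_neq0 act_mul act_scalar act_t not_tdiv hs s0.
have liftc : lift (f + g) (l - q%:Z) c.
  by split=> //; rewrite -rs sq rmorphM rmorphXn rho_t expr1n mul1r.
rewrite (vE fg0 liftc); have pc := lift_pi_neq0 liftc.
have [csupp _] := lowexpP le_ord pc.
have vg : v g = lowexp le (pi b) := vE g0 hb.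
have vf : v f = lowexp le (pi a) := vE f0 ha.
(* [q] measures the cancellation modulo t. If it is 0, the class of [s] is that of [b] when n > 0
   and the sum of both classes when n = 0. Otherwise the weight drops below that of [b], so the
   value is larger in the reversed order. *)
case: q sq hc liftc => [|q] sq hc liftc.
  have cs : c = s by rewrite sq expr0 mul1r.
  have piE : pi c = pi t ^+ n * pi a + pi b by rewrite cs rmorphD rmorphM rmorphXn.
  have pt : pi t = 0 by apply/pi_ker; exists 1; rewrite mulr1.
  rewrite piE in pc *; case: n {ln' s hs rs s0 sq cs piE} pc => [|n] pc.
    by move: pc; rewrite expr0 mul1r vf vg; exact: lowexpD.
  by move: hg; rewrite pt exprS !mul0r add0r vg.
apply: (gle_trans le_ord hg); apply: le_wt.
rewrite (pi_wt hc csupp) vg; have [bsupp _] := lowexpP le_ord pb.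
by rewrite (pi_wt hb1 bsupp) Num.Theory.ltrBlDr Num.Theory.ltrDl.
Qed.

Hypothesis domR : isdom R.

Lemma value_valuation : valuation le v.
Proof.
split=> [|f g f0 g0|c f c0 f0]; first exact: value_D.
  have [j [a ha]] := lifts f0; have [l [b hb]] := lifts g0.
  rewrite (vE (dommul_neq0 domR f0 g0) (lift_M ha hb)) (vE f0 ha) (vE g0 hb).
  by rewrite rmorphM (lowexpM le_ord (lift_pi_neq0 ha) (lift_pi_neq0 hb)).
have [j [a ha]] := lifts f0; have pa := lift_pi_neq0 ha; rewrite (vE f0 ha).
have cf0 : c *: f != 0.
  apply: contraNneq f0 => cf; rewrite -(scale1r f) -(mulVf c0) -scalerA cf.
  by rewrite scaler0.
have hca : lift (c *: f) j (iA c * a).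
  case: ha => ha ra ta; split.
  - rewrite -(add0r j); apply: (homogM act_mul) => //.
    exact: (homog_scalar act_scalar).
  - by rewrite rmorphM rho_scalar ra -scalerAl mul1r.
  - move=> b cab; apply: (ta (iA c^-1 * b)).
    rewrite mulrCA -cab mulrA -rmorphM mulVf // rmorph1 mul1r //.
rewrite (vE cf0 hca) rmorphM pi_scalar lowexpM ?mon_neq0 //.
by rewrite lowexp_mon // add0r.
Qed.

Variable S : Gam d -> Prop.
Hypothesis pi_supp : forall a s, s \in msupp (pi a) -> S s.
Hypothesis pi_mon : forall s, S s -> exists a, pi a = mon 1 s.

Lemma value_in_S f : f != 0 -> S (v f).
Proof.
move=> f0; have [j [a ha]] := lifts f0; rewrite (vE f0 ha).
by have [/pi_supp] := lowexpP le_ord (lift_pi_neq0 ha).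
Qed.

(** A preimage [a] of the monomial may mix weights, but exponents in the class of a weight-j
    component have weight j. Hence the component of weight [wt s] alone has the monomial as its
    class, and its image in [R] has value [s]. *)
Lemma value_semigroupE s : value_semigroup v s <-> S s.
Proof.
split=> [[f f0 <-]|/pi_mon[a pa]]; first exact: value_in_S.
have [r [c [ur hc aE]]] := homog_decomposition char0 act1 actM act_add act_mul
  act_scalar act_regular a.
have coefE s' : mcoeff s' (pi a) =
    if wt s' \in r then mcoeff s' (pi (c (wt s'))) else 0.
  have c0 j : wt s' != j -> mcoeff s' (pi (c j)) = 0.
    move=> wj; apply: mcoeff_outdom; apply: contra wj => hs'.
    by rewrite (pi_wt (hc j) hs').
  rewrite aE rmorph_sum raddf_sum; case: ifP => [wr|wr].
    rewrite (bigD1_seq (wt s')) //= big1 ?addr0 // => j.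
    by rewrite eq_sym => /c0.
  rewrite big_seq big1 // => j jr; apply: c0.
  by apply: contraFneq wr => ->.
have sr : wt s \in r.
  have := coefE s; rewrite pa /mon mcoeffUU; case: ifP => // _ /eqP.
  by rewrite oner_eq0.
have pc : pi (c (wt s)) = mon 1 s.
  apply/malgP => s'; have [ws|ws] := eqVneq (wt s') (wt s).
    by have := coefE s'; rewrite ws sr pa => <-.
  rewrite [RHS]mcoeffU; case: eqP => [ss|_]; first by rewrite ss eqxx in ws.
  apply: mcoeff_outdom; apply: contra ws => hs'.
  by rewrite (pi_wt (hc _) hs').
have pc0 : pi (c (wt s)) != 0 by rewrite pc; exact: mon_neq0 (oner_neq0 _).
have hl : lift (rho (c (wt s))) (wt s) (c (wt s)).
  by split=> // b cb; move/eqP: pc0; apply; apply/pi_ker; exists b.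
have rc0 : rho (c (wt s)) != 0.
  by apply: contraNneq pc0 => /(rho_inj (hc _)) ->; rewrite rmorph0.
exists (rho (c (wt s))) => //.
by rewrite (vE rc0 hl) pc lowexp_mon // oner_neq0.
Qed.
End InitialValuation.

(** * The isomorphism with the Laurent polynomials and the torus action *)

Section LaurentPolynomials.
Variables (k : fieldType) (R : comAlgType k).
Local Notation T := (mon 1 1 : monAlg R int).

Lemma laurent_of_polyX : laurent_of_poly R 'X = T.
Proof.
rewrite /laurent_of_poly size_polyX !big_ord_recl big_ord0 !coefX /=.
by rewrite scale0r scale1r [mon 0 _]monalgU0 add0r addr0.
Qed.

Lemma laurent_eval_poly c (c0 : c != 0) p :
  laurent_eval c0 (laurent_of_poly R p) = (p.[c])%:A.
Proof.
rewrite raddf_sum /= horner_coef scaler_suml; apply: eq_bigr => j _.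
by rewrite laurent_eval_mon -scalerAl mul1r scalerA.
Qed.

Lemma monT_expz (m : int) : exists G, mon 1 m - 1 = (T - 1) * G :> monAlg R int.
Proof.
have hn (n : nat) : exists G, mon 1 n%:Z - 1 = (T - 1) * G :> monAlg R int.
  have -> : mon 1 n%:Z = T ^+ n.
    by rewrite monX expr1n -[1 *+ n]/(n%:R) natz.
  by rewrite subrX1; eexists.
case: m => n; first exact: hn.
have [G GE] := hn n.+1; exists (- (mon 1 (Negz n) * G)).
rewrite mulrN mulrCA -GE mulrBr mulr1 monM mulr1 NegzE addNr mon1.
by rewrite opprB.
Qed.

(** If the coefficients f_m sum to 0, then f is the sum of the f_m (T^m - 1), and [monT_expz]
    divides each term. *)
Lemma laurent_eval1_div f : laurent_eval (oner_neq0 k) f = 0 ->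
  exists G, f = (T - 1) * G :> monAlg R int.
Proof.
rewrite /laurent_eval => f0; have fE : f = \sum_(m <- msupp f) mon (mcoeff m f) m.
  exact: monalgE.
have {}f0 : \sum_(m <- msupp f) mon (mcoeff m f) (0 : int) = 0 :> monAlg R int.
  have := congr1 (mkmalgU (0 : int)) f0; rewrite monalgU0 raddf_sum => h.
  rewrite -[RHS]h; apply: eq_bigr => m _.
  by rewrite exp1rz scale1r mulr1.
suff [G GE] : exists G : monAlg R int,
    \sum_(m <- msupp f) (mon (mcoeff m f) m - mon (mcoeff m f) 0) = (T - 1) * G.
  by exists G; rewrite -GE sumrB f0 subr0.
elim: (enum_fset (msupp f)) => [|m r [G GE]]; first by exists 0; rewrite big_nil mulr0.
have [G' G'E] := monT_expz m.
exists (mon (mcoeff m f) 0 * G' + G); rewrite big_cons GE mulrDr mulrCA -G'E mulrBr.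
by rewrite monM mulr1 add0r mulr1.
Qed.

Lemma laurent_eval_inj f : [pchar k] =i pred0 ->
  (forall c (c0 : c != 0), laurent_eval c0 f = 0) -> f = 0 :> monAlg R int.
Proof.
move=> char0 h; apply/malgP => m; rewrite mcoeff0.
have [mf|/mcoeff_outdom//] := boolP (m \in msupp f).
apply: (@power_indep k R (GRing.in_alg R) char0 (enum_fset (msupp f))
  (fun m => mcoeff m f)) mf => //; first exact: fset_uniq.
move=> z z0; rewrite -[RHS](h z z0); apply: eq_bigr => l _.
by rewrite mulrC.
Qed.
End LaurentPolynomials.

(** The numerator satisfies p(zw) = p(z) p(w). Comparing the coefficients of z^n, for some n with
    p_n nonzero, gives p(w) = w^n, so the exponent is n - m. *)
Lemma cocharacter_exponents (k : fieldType) d (lam : k -> 'I_d -> k) :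
  [pchar k] =i pred0 -> cocharacter lam ->
  exists l : 'I_d -> int, forall z, z != 0 -> forall j, lam z j = z ^ l j.
Proof.
move=> char0 hl; suff /choice[l hl'] : forall j, exists l : int,
    forall z, z != 0 -> lam z j = z ^ l.
  by exists l => z z0 j; exact: hl'.
move=> j; have [p [m hp]] := cochar_regular hl j.
have one0 := oner_neq0 k.
have lam1 : lam 1 j = 1.
  apply: (mulfI (cochar_neq0 hl one0 j)).
  by rewrite -(cochar_mul hl) // !mulr1.
have p1 : p.[1] = 1 by have := lam1; rewrite hp ?oner_neq0 // expr1n divr1.
have pM z w : z != 0 -> w != 0 -> p.[z * w] = p.[z] * p.[w].
  move=> z0 w0; have zw0 : z * w != 0 by exact: mulf_neq0.
  have := cochar_mul hl z0 w0 j; rewrite !hp // exprMn mulf_div => h.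
  apply: (mulIf _ h).
  by rewrite invr_eq0 mulf_neq0 // expf_neq0.
have pc w n : w != 0 -> p`_n * (w ^+ n - p.[w]) = 0.
  move=> w0; have [ltn|/(nth_default 0)->] := ltnP n (size p); last by rewrite mul0r.
  apply: (@power_indep k k idfun char0 [seq Posz n | n <- iota 0 (size p)]
    (fun m => p`_`|m|%N * (w ^+ `|m|%N - p.[w])) _ _ (Posz n)).
  - by rewrite map_inj_uniq ?iota_uniq // => a b [].
  - move=> z z0; have /eqP := pM z w z0 w0; rewrite !horner_coef mulr_suml.
    rewrite -subr_eq0 -sumrB => /eqP h; rewrite -[RHS]h big_map.
    rewrite -(big_mkord xpredT (fun i => p`_i * (z * w) ^+ i - p`_i * z ^+ i * _)).
    rewrite /index_iota subn0 -horner_coef; apply: eq_bigr => i _ /=.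
    by rewrite -exprnP exprMn; ring.
  - by rewrite map_f // mem_iota.
have [n pn] : exists n, p`_n != 0.
  apply: contrapT => h; have /eqP := p1; rewrite horner_coef big1 => [|i _].
    by rewrite eq_sym oner_eq0.
  have -> : p`_i = 0; last by rewrite mul0r.
  by apply: contrapT => /eqP pi0; apply: h; exists i.
exists (n%:Z - m%:Z) => z z0; rewrite hp // expfzDr // -exprnP -exprnN.
have /eqP := pc z n z0; rewrite mulf_eq0 (negbTE pn) /= subr_eq0 => /eqP->.
by [].
Qed.

Lemma torus_act_coeff (k : fieldType) d (tau : 'I_d -> k) (f : monAlg k (Gam d)) s :
  mcoeff s (torus_act tau f) =
  (\prod_(j < d) tau j ^ (s.2 0 j)) * mcoeff s f.
Proof.
rewrite /torus_act raddf_sum /=; have [sf|sf] := boolP (s \in msupp f).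
  rewrite (big_fsetD1 s) //= addrC big_seq big1 => [|s'].
    by rewrite add0r; exact: mcoeffUU.
  rewrite in_fsetD1 => /andP[/negbTE ss _].
  by rewrite [LHS]mcoeffU ss.
rewrite (mcoeff_outdom sf) mulr0 big_seq big1 // => s' s'f.
rewrite [LHS]mcoeffU; case: eqP => // ss; by rewrite -ss s'f in sf.
Qed.

(** The single point 2 of G_m is enough: in characteristic 0 its powers are distinct and determine
    the weight. *)
Lemma torus_act_weight (k : fieldType) d (l : 'I_d -> int) (tau : 'I_d -> k) z j
    (f : monAlg k (Gam d)) s : [pchar k] =i pred0 ->
  (forall i, tau i = 2%:R ^ l i) -> z = 2%:R ^ j -> z *: f = torus_act tau f ->
  s \in msupp f -> weight l s = j.
Proof.
move=> char0 tauE zE fE sf; have n2 : 2%:R != 0 :> k by exact: natk_neq0.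
have fs0 : mcoeff s f != 0 by rewrite mcoeff_neq0.
have e := etrans (esym (mcoeff_scale z f s)) (congr1 (mcoeff s) fE).
rewrite torus_act_coeff in e; apply: (expz2_inj char0).
rewrite -zE (mulIf fs0 e).
rewrite (eq_bigr (fun i => 2%:R ^ (l i * s.2 0 i))) => [|i _]; last first.
  by rewrite tauE exprz_exp.
rewrite /weight; apply: (big_morph (fun m : int => 2%:R ^ m)) => [x y|//].
exact: expfzDr.
Qed.

Lemma mmap_in_ksub (k : fieldType) (K : comNzRingType) (B : comAlgType K)
    (i : {rmorphism k -> B}) (E : B -> Prop) n (g : 'I_n -> B) p :
  ksub i E -> (forall c, E (c%:A)) -> (forall j, E (g j)) ->
  E (mpoly.mmap (@GRing.in_alg K B) g p).
Proof.
move=> hE Ec Eg; rewrite /mpoly.mmap; apply: (ksub_sum hE) => m _.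
apply: (ksubM hE); first exact: Ec.
by apply: (ksub_prod hE) => j _; apply: (ksubX hE).
Qed.

Lemma fg_kgenerated (k : fieldType) (B : comAlgType k) : finitely_generated B ->
  exists gs, kgenerated (GRing.in_alg B) gs.
Proof.
move=> [n [g hg]]; exists (codom g) => E hE Eg b; have [p ->] := hg b.
apply: (mmap_in_ksub p hE); first by move=> c; exact: (ksubC hE).
by move=> j; apply: Eg; exact: codom_f.
Qed.

Section PolyAlgebra.
Variables (k : fieldType) (A : comAlgType {poly k}).

Definition poly_scalar : {rmorphism k -> A} := GRing.in_alg A \o @polyC k.

Lemma poly_scalarE c : poly_scalar c = (c%:P)%:A. Proof. by []. Qed.

Lemma fg_poly_kgenerated : finitely_generated A ->
  exists gs, kgenerated poly_scalar gs.
Proof.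
move=> [n [g hg]]; exists (('X : {poly k})%:A :: codom g) => E hE Eg b.
have [p ->] := hg b; apply: (mmap_in_ksub p hE); last first.
  by move=> j; apply: Eg; rewrite inE codom_f orbT.
move=> c; rewrite -[c]coefK poly_def scaler_suml; apply: (ksub_sum hE) => j _.
have -> : (c`_j *: 'X^j)%:A = poly_scalar c`_j * ('X : {poly k})%:A ^+ j :> A.
  rewrite poly_scalarE -mul_polyC -scalerA -scalerAl mul1r; congr (_ *: _).
  by rewrite -[X in _ = X ^+ _]/(GRing.in_alg A 'X) -rmorphXn.
apply: (ksubM hE); first exact: (ksubC hE).
by apply: (ksubX hE); apply: Eg; exact: mem_head.
Qed.
End PolyAlgebra.

Theorem theorem1p11
  (k : closedFieldType) (char0 : [pchar k] =i pred0)
  (* R, a finitely generated positively graded k-domain *)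
  (R : comAlgType k) (grR : nat -> R -> Prop)
  (R_domain : GRing.integral_domain_axiom R)
  (R_fg : finitely_generated R)
  (R_graded : pos_grading grR)
  (* A, a finitely generated positively graded k[t]-algebra, a domain *)
  (A : comAlgType {poly k}) (grA : nat -> A -> Prop)
  (A_domain : GRing.integral_domain_axiom A)
  (A_fg : finitely_generated A)
  (A_graded : pos_grading grA)
  (* (a) *)
  (AL : comAlgType {poly k}) (loc : {lrmorphism A -> AL})
  (AL_loc : is_localization_at_t loc)
  (phi : {rmorphism AL -> laurent R})
  (phi_bij : bijective phi)
  (phi_lin : forall (p : {poly k}) (x : AL),
     phi (p *: x) = laurent_of_poly R p * phi x)
  (phi_graded : forall (n : nat) (x : AL),
     loc_gr loc grA n x <-> laurent_gr grR n (phi x))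
  (* (b) *)
  (I : idealr A) (I_t : is_t_ideal I)
  (d : nat) (S : Gam d -> Prop)
  (S_fg : fg_semigroup S)
  (S_pos : forall s, S s -> 0 <= s.1)
  (psi : {rmorphism {ideal_quot I} -> monAlg k (Gam d)})
  (psi_iso : graded_iso_semigroup_algebra grA S psi)
  (* (c) *)
  (act : k -> A -> A)
  (act_Gm : Gm_action act)
  (act_std : extends_standard act)
  (act_gr : respects_grading act grA)
  (lam : k -> 'I_d -> k)
  (lam_cochar : cocharacter lam)
  (act_torus : forall z, z != 0 -> forall a : A,
     psi (cls I (act z a)) = torus_act (lam z) (psi (cls I a))) :
  exists (le : rel (Gam d)) (v : R -> Gam d),
    [/\ total_group_order le,
        valuation le v,
        forall f, f != 0 -> 0 <= (v f).1,
        full_rank v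
      & exists psi' : {rmorphism {ideal_quot I} -> monAlg k (Gam d)},
          graded_iso_semigroup_algebra grA (value_semigroup v) psi'].
Proof.
have domA : isdom A by move=> x y /A_domain/orP[]/eqP; [left|right].
have domR : isdom R by move=> x y /R_domain/orP[]/eqP; [left|right].
pose iA : {rmorphism k -> A} := poly_scalar A.
pose iR : {rmorphism k -> R} := GRing.in_alg R.
pose t : A := ('X : {poly k})%:A.
have scaleE (p : {poly k}) (a : A) : p *: a = p%:A * a by rewrite -scalerAl mul1r.
have tXE m (a : A) : ('X^m : {poly k}) *: a = t ^+ m * a.
  rewrite scaleE; congr (_ * _).
  by rewrite -[LHS]/(GRing.in_alg A ('X^m)) rmorphXn.
have t0 : t != 0.
  apply/eqP => t0; have [u uE] := loc_unit AL_loc.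
  have /eqP := uE; have -> : ('X : {poly k})%:A = loc t :> AL.
    by rewrite linearZ rmorph1.
  by rewrite t0 rmorph0 mul0r eq_sym oner_eq0.
have loc_inj a : loc a = 0 -> a = 0.
  move=> /(loc_ker AL_loc)[m]; rewrite tXE => /domA[/eqP|//].
  by rewrite (negbTE (domexp_neq0 domA m t0)).
have phi_inj := bij_inj phi_bij.
(* Specialization at t = c through R[t, t^-1]; [rho] is the case c = 1, and the other points serve
   to prove [rho_inj]. *)
pose ev c (c0 : c != 0) : A -> R := fun a => laurent_eval c0 (phi (loc a)).
pose rho : {rmorphism A -> R} := laurent_eval (oner_neq0 k) \o phi \o loc.
have phi_loc p a : phi (loc (p *: a)) = laurent_of_poly R p * phi (loc a).
  by rewrite linearZ phi_lin.
have evM c (c0 : c != 0) a b : ev c c0 (a * b) = ev c c0 a * ev c c0 b.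
  by rewrite /ev !rmorphM.
have ev_alg c (c0 : c != 0) p : ev c c0 p%:A = (p.[c])%:A.
  by rewrite /ev phi_loc !rmorph1 mulr1 laurent_eval_poly.
have rho_scalar c : rho (iA c) = c%:A.
  by rewrite -[LHS]/(ev 1 (oner_neq0 k) (c%:P)%:A) ev_alg hornerC.
have rho_t : rho t = 1.
  by rewrite -[LHS]/(ev 1 (oner_neq0 k) ('X)%:A) ev_alg hornerX scale1r.
have rho_surj r : exists a, rho a = r.
  have [psi' psiK phiK] := phi_bij; have [m [a ha]] := loc_frac AL_loc (psi' (mon r 0)).
  exists a; rewrite -[LHS]/(laurent_eval (oner_neq0 k) (phi (loc a))) -ha phi_lin phiK.
  rewrite (laurent_evalM R (oner_neq0 k)).2 laurent_eval_poly hornerXn.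
  rewrite expr1n laurent_eval_mon expr0z.
  by rewrite !scale1r mulr1 mul1r.
have act_scalar z : z != 0 -> forall c, act z (iA c) = iA c.
  by move=> z0 c; rewrite [LHS](act_std _ z0) comp_polyC.
have act_t z : z != 0 -> act z t = iA z * t.
  move=> z0; rewrite [LHS](act_std _ z0) comp_polyX -mul_polyC.
  by rewrite -[LHS]/(GRing.in_alg A (z%:P * 'X)) rmorphM.
have act_regular a : exists (N : nat) (e : 'I_N -> int) (b : 'I_N -> A),
    forall z, z != 0 -> act z a = \sum_(i < N) iA (z ^ e i) * b i.
  have [N [e [b h]]] := gm_regular act_Gm a; exists N, e, b => z z0.
  by rewrite h //; apply: eq_bigr => j _; rewrite scaleE.
have act_one := gm_one act_Gm; have act_M := gm_mul act_Gm.
have act_D := gm_D act_Gm; have act_mul := gm_M act_Gm.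
(* Division by T - 1 takes place in the localization; the power t^m that this costs is removed again
   because t^m - 1 is a multiple of t - 1. *)
have rho_ker a : rho a = 0 -> exists b, a = (t - 1) * b.
  move=> /laurent_eval1_div[G GE]; have [psi' psiK phiK] := phi_bij.
  have [m [b bE]] := loc_frac AL_loc (psi' G).
  have eq1 : t ^+ m * a = (t - 1) * b.
    have hb : phi (loc b) = laurent_of_poly R 'X^m * G by rewrite -bE phi_lin phiK.
    have htb : phi (loc ((t - 1) * b)) = (mon 1 1 - 1) * phi (loc b).
      rewrite mulrBl mul1r mulrBl mul1r -scaleE rmorphB rmorphB phi_loc.
      by rewrite laurent_of_polyX.
    apply/eqP; rewrite -subr_eq0; apply/eqP/loc_inj/phi_inj; rewrite !rmorph0.
    by rewrite !rmorphB htb hb -tXE phi_loc GE mulrCA subrr.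
  exists (b - (\sum_(i < m) t ^+ i) * a); rewrite mulrBr mulrA -subrX1 -eq1.
  by rewrite mulrBl mul1r subKr.
(* Write [a = (t - 1) * b]. Acting by c^-1 rescales [a] and turns t - 1 into c^-1 t - 1, which
   vanishes at t = c. So [a] vanishes at every nonzero c, and its Laurent polynomial is zero. *)
have rho_inj j a : homog iA act j a -> rho a = 0 -> a = 0.
  move=> ha /rho_ker[b ab]; apply/loc_inj/phi_inj; rewrite rmorph0.
  apply: laurent_eval_inj => // c c0; have z0 : c^-1 != 0 by rewrite invr_eq0.
  have := ha _ z0; rewrite {1}ab act_mul // => /(congr1 (ev c c0)); rewrite !evM.
  have -> : ev c c0 (act c^-1 (t - 1)) = 0.
    have -> : act c^-1 (t - 1) = ((c^-1)%:P * 'X - 1)%:A.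
      rewrite -[t - 1]/(GRing.in_alg A 'X - 1) -(rmorph1 (GRing.in_alg A)) -rmorphB.
      rewrite [LHS](act_std _ z0) comp_polyB comp_polyX -mul_polyC.
      rewrite -polyC1 comp_polyC; congr (_ *: _).
      exact: (esym (rmorph1 (GRing.in_alg A))).
    by rewrite ev_alg !hornerE mulVf // subrr scale0r.
  rewrite mul0r ev_alg hornerC -scalerAl mul1r => /esym/eqP.
  by rewrite scaler_eq0 expfz_eq0 (negbTE z0) andbF /= => /eqP.
pose pi : {rmorphism A -> monAlg k (Gam d)} :=
  psi \o (\pi_({ideal_quot I}))%qT.
have piE a : pi a = psi (cls I a) by [].
have pi_scalar c : pi (iA c) = mon c 0.
  rewrite piE -[iA c]/(c%:P *: 1) (iso_linear psi_iso) -piE rmorph1.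
  by rewrite mon_scalar.
have pi_ker a : pi a = 0 <-> exists b, a = t * b.
  have clsE : cls I a = 0 <-> a \in I.
    have -> : (a \in I) = (cls I a == cls I 0).
      by rewrite -[in LHS](subr0 a) Quotient.idealrBE.
    by rewrite [cls I 0]rmorph0; split=> [->|/eqP].
  split=> [|[b ->]].
    rewrite piE -(rmorph0 psi) => /(iso_inj psi_iso)/clsE/I_t[b ->].
    by exists b; rewrite scaleE.
  rewrite piE (_ : cls I (t * b) = 0) ?rmorph0 //.
  have /I_t : exists b', t * b = 'X *: b' by exists b; rewrite scaleE.
  by move=> tbI; apply/eqP; rewrite -(rmorph0 (\pi_({ideal_quot I}))%qT) -Quotient.idealrBE subr0.
have [l lamE] := cocharacter_exponents char0 lam_cochar.
have pi_wt j a s : homog iA act j a -> s \in msupp (pi a) -> weight l s = j.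
  move=> ha; have n2 : 2%:R != 0 :> k by exact: natk_neq0.
  apply: (torus_act_weight char0 (fun i => lamE _ n2 i) (erefl (2%:R ^ j))).
  have actE : act 2%:R a = (2%:R ^ j)%:P *: a by rewrite ha // scaleE.
  by rewrite [RHS](esym (act_torus _ n2 a)) actE (iso_linear psi_iso).
have [n [g SE]] := S_fg.
have pi_supp a s : s \in msupp (pi a) -> S s.
  by apply: (proj1 (iso_image psi_iso (pi a))); exists (cls I a).
have pi_mon s : S s -> exists a, pi a = mon 1 s.
  move=> Ss; have [x xE] : exists x, psi x = mon 1 s.
    apply/(iso_image psi_iso) => s' /(fsubsetP msuppU_le).
    by rewrite in_fset1 => /eqP->.
  by exists (repr x)%qT; rewrite piE /cls reprK.
have /choice[L LE] : forall s, exists a, S s -> pi a = mon 1 s.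
  move=> s; have [/pi_mon[a aE]|nS] := pselect (S s); first by exists a.
  by exists 0.
have Sg j : S (g j).
  apply/SE; exists (fun j' => (j' == j)%N : nat).
  by rewrite (bigD1 j) //= eqxx mulr1n big1 ?addr0 // => j' /negbTE->.
have [b [hb sb tb]] := zbasis (codom g).
have bS s : s \in b -> S s by move=> /sb/codomP[j ->].
have gb j : ztorsion b (g j) by apply: tb; exact: codom_f.
have Sb s : S s -> ztorsion b s.
  move=> /SE[c ->]; apply: (big_ind (ztorsion b)) => [||j _].
  - exact: ztorsion0.
  - exact: ztorsionD.
  - by rewrite pmulrn; exact: ztorsionZ.
have le_ord := gam_le_order l.
have domC := monAlg_dom le_ord (k := k).
pose hs := map L b.
have pi_hs : map pi hs = map (mon 1) b.
  by rewrite -map_comp; apply/eq_in_map => s /bS /LE.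
have pi_h j : pi (L (g j)) = mon 1 (g j) by exact: LE.
have gens_inj x : gens iA hs x -> pi x = 0 -> x = 0.
  have iC c : pi (iA c) = GRing.in_alg (monAlg k (Gam d)) c.
    by rewrite pi_scalar mon_scalar.
  (* [val_indep] is applied to k[Z x Z^d] itself with the valuation [lowexp], under which the
     monomials take the independent values [b]. *)
  move=> hx; suff ihs : indep (GRing.in_alg (monAlg k (Gam d))) (map pi hs).
    by have [_] := gens_morph_inj iC ihs hx; apply.
  have [||//] := @val_indep _ _ _ _ _ le_ord (lowexp_valuation le_ord k) domC (map pi hs).
    by move=> f; rewrite pi_hs => /mapP[s _ ->]; apply: mon_neq0; exact: oner_neq0.
  rewrite pi_hs -map_comp (eq_map (g := id)) ?map_id // => s /=.
  by apply: lowexp_mon; rewrite ?oner_neq0.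
have [gsA gsA_gen] := fg_poly_kgenerated A_fg.
have not_tdiv a : a != 0 -> exists m, forall c, a <> t ^+ m * c.
  exact: (not_t_divisible char0 domA domC pi_scalar pi_ker gsA_gen SE pi_supp
    pi_h gb pi_hs gens_inj t0).
have [v vE] := lift_value_exists char0 domA t0 act_one act_M act_D act_mul
  act_scalar act_t act_regular rho_t rho_inj rho_surj not_tdiv (gam_le l) pi.
have le_wt := @gam_le_weight d l.
have hval : valuation (gam_le l) v.
  exact: (value_valuation char0 domA t0 act_one act_M act_D act_mul act_scalar
    act_t act_regular rho_scalar rho_t rho_surj not_tdiv le_ord le_wt
    pi_scalar pi_ker pi_wt vE domR).
have vS s : value_semigroup v s <-> S s.
  exact: (value_semigroupE char0 domA t0 act_one act_M act_D act_mul act_scalar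
    act_t act_regular rho_t rho_inj rho_surj not_tdiv le_ord
    pi_ker pi_wt vE pi_supp pi_mon).
exists (gam_le l), v; split=> //.
- by move=> f f0; apply: S_pos; apply/vS; exists f.
- have [gsR gsR_gen] := fg_kgenerated R_fg.
  (* [F] realizes the exponents in [S] as values; the elements with values [b] are independent,
     which bounds the dimension from below. *)
  have /choice[F FE] : forall s, exists f, S s -> f != 0 /\ v f = s.
    move=> s; have [/vS[f f0 fs]|nS] := pselect (S s); first by exists f.
    by exists 0.
  have vF : map v (map F b) = b.
    by rewrite -map_comp -[RHS]map_id; apply/eq_in_map => s /bS /FE[].
  have [iF _] : indep iR (map F b) /\ forall x, gens iR (map F b) x -> x != 0 ->
      zspan (map v (map F b)) (v x).
    apply: (val_indep le_ord hval domR); last by rewrite vF.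
    by move=> f /mapP[s /bS/FE[f0 _] ->].
  have [m le_bm [p hp]] := prime_chain_exists char0 domR gsR_gen iF.
  have ub m' (p' : nat -> {pred R}) : prime_chain m' p' -> (m' <= size b)%N.
    move=> hp'; apply: (quotient_chain_le char0 domA domC pi_scalar pi_ker gsA_gen
      SE pi_supp pi_h gb pi_hs rho_surj _ hp').
    (* This kernel element is nonzero because its class modulo t is -1. *)
    exists (t - 1); last by rewrite rmorphB rho_t rmorph1 subrr.
    apply/eqP => t1; have /eqP : pi (t - 1) = 0 by rewrite t1 rmorph0.
    rewrite rmorphB rmorph1 (proj2 (pi_ker t)) ?sub0r ?oppr_eq0 ?oner_eq0 //.
    by exists 1; rewrite mulr1.
  have mb : m = size b.
    by apply/eqP; rewrite eqn_leq (ub m p hp) -(size_map F b).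
  exists (size b).
    by apply: has_rank_basis => // s; [move=> /bS/vS|move=> /vS/Sb].
  by split=> //; exists p; rewrite -mb.
(* The values form exactly [S], so the given isomorphism already has the required image. *)
- exists psi; split; [exact: iso_linear psi_iso|exact: iso_inj psi_iso| |].
    move=> f; rewrite (iso_image psi_iso); split=> hf s /hf; first by move/vS.
    by move/vS.
  exact: iso_graded psi_iso.
Qed.
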